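(* The $3$-fold projective tensor product $c_0\widehat{\otimes}_\pi c_0\widehat{\otimes}_\pi c_0$ is not isomorphic to a subspace of $c_0\widehat{\otimes}_\pi c_0$.
   Context: $c_0$ is the Banach space of scalar sequences converging to $0$ with the supremum norm. For Banach spaces $X,Y$, the projective tensor norm of $u=\sum_{i=1}^n a_i\otimes b_i\in X\otimes Y$ is $\|u\|=\sup\{|\sum_{i=1}^n\varphi(a_i,b_i)| : \varphi \text{ a bounded bilinear functional on } X\times Y,\ \|\varphi\|\le 1\}$, and $X\widehat{\otimes}_\pi Y$ is the completion of $X\otimes Y$ for this norm. The $3$-fold product is obtained by iterating (the projective tensor product is associative). ''Isomorphic'' means linearly homeomorphic: $X$ is isomorphic to a subspace of $Y$ if there is a bounded linear map $T:X\to Y$ and $c>0$ with $\|Tx\|\ge c\|x\|$ for all $x\in X$. *)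

(* Defs.v *)
From HB Require Import structures.
From mathcomp Require Import all_boot all_order all_algebra.
From mathcomp Require Import sesquilinear complex.
From mathcomp Require Import all_classical all_reals topology normedtype sequences.

Set Implicit Arguments.
Unset Strict Implicit.
Unset Printing Implicit Defensive.

Import Order.TTheory GRing.Theory Num.Theory.
Import numFieldNormedType.Exports.

Local Open Scope classical_set_scope.
Local Open Scope ring_scope.

Section NullSequences.
Variable K : numFieldType.

Definition null_seq : {pred nat -> K^o} :=
  [pred x : nat -> K^o | `[< x @ \oo --> (0 : K^o) >]].

Lemma null_seqP (x : nat -> K^o) :
  reflect (x @ \oo --> (0 : K^o)) (x \in null_seq).
Proof. exact: asboolP. Qed.

Lemma null_seq_submod_closed : submod_closed null_seq.
Proof.
split; first by apply/null_seqP; exact: cvg_cst.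
move=> a x y /null_seqP x0 /null_seqP y0; apply/null_seqP.
rewrite -[X in _ --> X](addr0 (0 : K^o)) -[X in _ --> X + _](scaler0 _ a).
by apply: cvgD => //; apply: cvgZl_tmp.
Qed.

HB.instance Definition _ :=
  GRing.isSubmodClosed.Build K (nat -> K^o) null_seq null_seq_submod_closed.

Definition c0 : Type := {x : nat -> K^o | x \in null_seq}.

HB.instance Definition _ := SubChoice.on c0.
HB.instance Definition _ := [SubChoice_isSubLmodule of c0 by <:].

Definition c0_norm (x : c0) : K := supremum 0 (range (fun n => `|\val x n|)).

Lemma c0_norm_max (x : c0) : exists k, forall n, `|\val x n| <= `|\val x k|.
Proof.
case: x => x /= /null_seqP x0.
have [x_0|/existsNP[m /eqP xm]] := pselect (forall n, x n = 0).
  by exists 0%N => n; rewrite !x_0.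
have maxN N : exists k, forall i, (i < N.+1)%N -> `|x i| <= `|x k|.
  elim: N => [|N [k kP]]; first by exists 0%N; case=> [|i].
  have [le_kN|lt_Nk] :=
    real_leP (normr_real (x k)) (normr_real (x N.+1)).
    exists N.+1 => i; rewrite ltnS leq_eqVlt => /predU1P[->//|/kP ik].
    exact: le_trans le_kN.
  exists k => i; rewrite ltnS leq_eqVlt => /predU1P[->|/kP//].
  exact: ltW.
have xm_gt0 : 0 < `|x m| by rewrite normr_gt0.
have /cvgrPdist_lt /(_ _ xm_gt0) [N _ NP] := x0.
have [k kP] := maxN (N + m)%N.
exists k => n; have [nN|Nn] := ltnP n (N + m).+1; first exact: kP.
have /NP : (N <= n)%N by rewrite (leq_trans (leq_addr m N))// ltnW.
rewrite /= sub0r normrN => /ltW/le_trans; apply; apply: kP.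
by rewrite ltnS leq_addl.
Qed.

Lemma c0_norm_supremums (x : c0) :
  supremums (range (fun n => `|\val x n|)) (c0_norm x).
Proof.
have [k kP] := c0_norm_max x.
rewrite /c0_norm /supremum ifF; last by apply/eqP/eqP/set0P; exists `|\val x 0%N|, 0%N.
apply: xgetPex; exists `|\val x k|; split; first by move=> _ [n _ <-].
by move=> u; apply; exists k.
Qed.

Lemma c0_norm_ge (x : c0) n : `|\val x n| <= c0_norm x.
Proof. by have [+ _] := c0_norm_supremums x; apply; exists n. Qed.

Lemma c0_norm_le (x : c0) (M : K) :
  (forall n, `|\val x n| <= M) -> c0_norm x <= M.
Proof.
by move=> xM; have [_ +] := c0_norm_supremums x; apply=> _ [n _ <-].
Qed.

Lemma c0_ler_normD (x y : c0) : c0_norm (x + y) <= c0_norm x + c0_norm y.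
Proof.
apply: c0_norm_le => n; rewrite raddfD/=.
by apply: le_trans (ler_normD _ _) _; apply: lerD; exact: c0_norm_ge.
Qed.

Lemma c0_normrZ (a : K) (x : c0) : c0_norm (a *: x) = `|a| * c0_norm x.
Proof.
have le_norm b y : c0_norm (b *: y) <= `|b| * c0_norm y.
  apply: c0_norm_le => n; rewrite linearZ/= normrM.
  by apply: ler_wpM2l => //; exact: c0_norm_ge.
apply/eqP; rewrite eq_le le_norm/=.
have [->|a0] := eqVneq a 0.
  rewrite normr0 mul0r; apply: le_trans (c0_norm_ge _ 0%N); exact: normr_ge0.
rewrite -ler_pdivlMl ?normr_gt0// -normfV.
by apply: le_trans (le_norm _ _); rewrite scalerA mulVf// scale1r.
Qed.

Lemma c0_norm0_eq0 (x : c0) : c0_norm x = 0 -> x = 0.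
Proof.
move=> x0; apply/val_inj/funext => n; rewrite raddf0.
by have := c0_norm_ge x n; rewrite x0 normr_le0 => /eqP.
Qed.

HB.instance Definition _ :=
  Lmodule_isNormed.Build K c0 c0_ler_normD c0_normrZ c0_norm0_eq0.

End NullSequences.

Lemma c0_normE (K : numFieldType) (x : c0 K) :
  `|x| = supremum 0 (range (fun n => `|\val x n|)).
Proof. by []. Qed.

Section ProjectiveTensorProduct.
Variable K : numFieldType.
Variables X Y : normedModType K.

Definition bilinear_norm_le1 (phi : {bilinear X -> Y -> K^o}) : Prop :=
  forall x y, `|phi x y| <= `|x| * `|y|.

(* By its universal property, a linear map X (x) Y -> Z is a bilinear map
   t : X -> Y -> Z. The predicate says that Z is a completion of X (x) Y for
   the projective norm through t. Every element of X (x) Y is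
   \sum_(p <- s) p.1 (x) p.2 for some s. *)
Record projective_tensor_product (Z : completeNormedModType K)
    (t : {bilinear X -> Y -> Z}) : Prop := {
  projective_tensor_norm : forall s : seq (X * Y),
    supremums [set `|\sum_(p <- s) phi p.1 p.2| | phi in bilinear_norm_le1]
              `|\sum_(p <- s) t p.1 p.2| ;
  projective_tensor_dense :
    dense (range (fun s : seq (X * Y) => \sum_(p <- s) t p.1 p.2)) }.

End ProjectiveTensorProduct.

Definition isomorphic_to_subspace (K : numFieldType) (X Y : normedModType K) :=
  exists T : {linear X -> Y},
    (exists C : K, forall x, `|T x| <= C * `|x|) /\
    (exists2 c : K, 0 < c & forall x, c * `|x| <= `|T x|).

Definition nonneg_lub (K : numFieldType) := forall A : set K,
  A !=set0 -> (forall a, A a -> 0 <= a) -> ubound A !=set0 ->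
  supremums A !=set0.

Definition filter_complete (K : numFieldType) :=
  forall F : set_system K^o, ProperFilter F -> cauchy F -> cvg F.

(* Existence: X (x) Y embeds isometrically, by evaluation, into the bounded
   scalar functions on the unit ball of the bounded bilinear functionals on
   X x Y, and its completion is realized as the uniform closure of the image. *)
Section Existence.
Variable K : numFieldType.
Hypotheses (lubK : nonneg_lub K) (complK : filter_complete K).
Variables X Y : normedModType K.

Let ball1 : Type := {phi : {bilinear X -> Y -> K^o} | bilinear_norm_le1 phi}.

Let zero_bilin (x : X) (y : Y) : K^o := 0.

Lemma zero_bilin_bilinear : bilinear_for *:%R *:%R zero_bilin.
Proof. by split=> x a u v; rewrite /= /zero_bilin [RHS]addr0 [RHS]mulr0. Qed.

HB.instance Definition _ := bilinear_isBilinear.Build K X Y K^o *:%R *:%R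
  zero_bilin zero_bilin_bilinear.

Let phi0 : ball1.
Proof.
exists (zero_bilin : {bilinear X -> Y -> K^o}) => x y.
by rewrite /zero_bilin normr0 mulr_ge0.
Defined.

Definition tensor_eval (s : seq (X * Y)) : ball1 -> K^o :=
  fun phi => \sum_(p <- s) (sval phi) p.1 p.2.

Definition in_ptensor : {pred ball1 -> K^o} :=
  [pred F : ball1 -> K^o | `[< forall e : K, 0 < e ->
    exists s, forall phi, `|F phi - tensor_eval s phi| <= e >]].

Lemma tensor_eval_cat s1 s2 phi : tensor_eval (s1 ++ s2) phi = tensor_eval s1 phi + tensor_eval s2 phi.
Proof. by rewrite /tensor_eval big_cat. Qed.

Lemma tensor_eval_scale a s phi :
  tensor_eval [seq (a *: p.1, p.2) | p <- s] phi = a *: tensor_eval s phi.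
Proof.
rewrite /tensor_eval big_map scaler_sumr; apply: eq_bigr => -[x y] _ /=.
exact: linearZl_LR.
Qed.

Lemma in_ptensor_eval s : tensor_eval s \in in_ptensor.
Proof. by apply/asboolP => e e0; exists s => phi; rewrite subrr normr0 ltW. Qed.

Lemma in_ptensor_submod_closed : submod_closed in_ptensor.
Proof.
split.
  apply/asboolP => e e0; exists [::] => phi.
  by rewrite /tensor_eval big_nil subr0 normr0 ltW.
move=> a F G /asboolP FP /asboolP GP; apply/asboolP => e e0.
have d0 : 0 < e / 2 / (`|a| + 1).
  by rewrite !divr_gt0// ltr_wpDl.
have [s sP] := FP _ d0.
have [t tP] := GP _ (divr_gt0 e0 (@ltr0Sn K 1)).
exists ([seq (a *: p.1, p.2) | p <- s] ++ t) => phi.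
have -> : (a *: F + G) phi - tensor_eval ([seq (a *: p.1, p.2) | p <- s] ++ t) phi =
    a *: (F phi - tensor_eval s phi) + (G phi - tensor_eval t phi).
  by rewrite tensor_eval_cat tensor_eval_scale scalerBr opprD addrACA.
rewrite (splitr e).
apply: le_trans (ler_normD _ _) (lerD _ _); last exact: tP.
rewrite normrZ; apply: le_trans (ler_wpM2l _ (sP phi)) _ => //.
rewrite mulrCA ger_pMr ?divr_gt0// ler_pdivrMr ?ltr_wpDl// mul1r.
by rewrite lerDl.
Qed.

HB.instance Definition _ :=
  GRing.isSubmodClosed.Build K (ball1 -> K^o) in_ptensor in_ptensor_submod_closed.

(* The vacuous lets make the instances below depend on lubK and complK. *)
Definition ptensor : Type := let _ := lubK in let _ := complK in
  {F : ball1 -> K^o | F \in in_ptensor}.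

HB.instance Definition _ := SubChoice.copy ptensor {F : ball1 -> K^o | F \in in_ptensor}.
HB.instance Definition _ := [SubChoice_isSubLmodule of ptensor by <:].

Lemma tensor_eval_bounded s : exists M : K, forall phi, `|tensor_eval s phi| <= M.
Proof.
exists (\sum_(p <- s) `|p.1| * `|p.2|) => phi.
apply: le_trans (ler_norm_sum _ _ _) _.
by apply: ler_sum => p _; exact: (svalP phi).
Qed.

Definition ptensor_norm (F : ptensor) : K :=
  supremum 0 (range (fun phi => `|\val F phi|)).

Lemma ptensor_norm_supremums (F : ptensor) :
  supremums (range (fun phi => `|\val F phi|)) (ptensor_norm F).
Proof.
rewrite /ptensor_norm /supremum ifF; last first.
  by apply/eqP/eqP/set0P; exists `|\val F phi0|, phi0.
apply: xgetPex; apply: lubK.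
- by exists `|\val F phi0|, phi0.
- by move=> _ [phi _ <-].
- have /asboolP/(_ 1 ltr01)[s sP] := valP F.
  have [M MP] := tensor_eval_bounded s.
  exists (1 + M) => _ [phi _ <-].
  rewrite -[\val F phi](subrK (tensor_eval s phi)).
  by apply: le_trans (ler_normD _ _) _; apply: lerD.
Qed.

Lemma ptensor_norm_ge (F : ptensor) phi : `|\val F phi| <= ptensor_norm F.
Proof. by have [+ _] := ptensor_norm_supremums F; apply; exists phi. Qed.

Lemma ptensor_norm_le (F : ptensor) (M : K) :
  (forall phi, `|\val F phi| <= M) -> ptensor_norm F <= M.
Proof.
by move=> FM; have [_ +] := ptensor_norm_supremums F; apply=> _ [phi _ <-].
Qed.

Lemma ptensor_ler_normD (x y : ptensor) : ptensor_norm (x + y) <= ptensor_norm x + ptensor_norm y.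
Proof.
apply: ptensor_norm_le => n; rewrite raddfD/=.
by apply: le_trans (ler_normD _ _) _; apply: lerD; exact: ptensor_norm_ge.
Qed.

Lemma ptensor_normrZ (a : K) (x : ptensor) : ptensor_norm (a *: x) = `|a| * ptensor_norm x.
Proof.
have le_norm b y : ptensor_norm (b *: y) <= `|b| * ptensor_norm y.
  apply: ptensor_norm_le => n; rewrite linearZ/= normrM.
  by apply: ler_wpM2l => //; exact: ptensor_norm_ge.
apply/eqP; rewrite eq_le le_norm/=.
have [->|a0] := eqVneq a 0.
  rewrite normr0 mul0r; apply: le_trans (ptensor_norm_ge _ phi0); exact: normr_ge0.
rewrite -ler_pdivlMl ?normr_gt0// -normfV.
by apply: le_trans (le_norm _ _); rewrite scalerA mulVf// scale1r.
Qed.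

Lemma ptensor_norm0_eq0 (x : ptensor) : ptensor_norm x = 0 -> x = 0.
Proof.
move=> x0; apply/val_inj/funext => phi; rewrite raddf0.
by have := ptensor_norm_ge x phi; rewrite x0 normr_le0 => /eqP.
Qed.

HB.instance Definition _ :=
  Lmodule_isNormed.Build K ptensor ptensor_ler_normD ptensor_normrZ ptensor_norm0_eq0.

Lemma ptensor_complete (G : set_system ptensor) : ProperFilter G -> cauchy G -> cvg G.
Proof.
move=> GG /cauchy_ballP Gc.
have Gcv phi : cvg ((fun F : ptensor => \val F phi : K^o) @ G).
  apply: complK; apply/cauchy_ballP => e e0.
  have := Gc _ e0; rewrite !near_simpl => H.
  rewrite near_map2; apply: filterS H => -[F1 F2] /=.
  rewrite -!ball_normE /= => H; apply: le_lt_trans H.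
  by have := ptensor_norm_ge (F1 - F2) phi; rewrite raddfB.
pose L phi : K^o := lim ((fun F : ptensor => \val F phi : K^o) @ G).
have unif e : 0 < e -> \forall F \near G, forall phi, `|L phi - \val F phi| <= e.
  move=> e0; have e2 := divr_gt0 e0 (@ltr0Sn K 1).
  have /nearP_dep := Gc _ e2; apply: filterS => F1 FP phi.
  have /cvgrPdist_lt/(_ _ e2) LP : (fun F : ptensor => \val F phi : K^o) @ G --> L phi.
    exact: Gcv.
  have [F2 [L2 F12]] := filter_ex (filterI LP FP).
  rewrite -[L phi](subrK (\val F2 phi)) -addrA (splitr e).
  apply: le_trans (ler_normD _ _) (lerD (ltW L2) _).
  move: F12; rewrite -ball_normE /= distrC => /ltW; apply: le_trans.
  by have := ptensor_norm_ge (F2 - F1) phi; rewrite raddfB.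
have LT : L \in in_ptensor.
  apply/asboolP => e e0.
  have [F FP] := filter_ex (unif _ (divr_gt0 e0 (@ltr0Sn K 1))).
  have /asboolP/(_ _ (divr_gt0 e0 (@ltr0Sn K 1)))[s sP] := valP F.
  exists s => phi; rewrite -[L phi](subrK (\val F phi)) -addrA.
  by rewrite (splitr e); apply: le_trans (ler_normD _ _) (lerD _ _).
apply/cvg_ex; exists (Sub L LT : ptensor).
apply/cvgrPdist_le => e e0; have := unif _ e0; apply: filterS => F FP.
by apply: ptensor_norm_le => phi; rewrite raddfB; exact: FP.
Qed.

HB.instance Definition _ := Uniform_isComplete.Build ptensor ptensor_complete.

Definition ptensor_map (x : X) (y : Y) : ptensor := Sub (tensor_eval [:: (x, y)]) (in_ptensor_eval _).

Lemma ptensor_map_bilinear : bilinear_for *:%R *:%R ptensor_map.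
Proof.
split=> [y|x] a u v; apply/val_inj/funext => phi.
  change (tensor_eval [:: (a *: u + v, y)] phi =
    a *: tensor_eval [:: (u, y)] phi + tensor_eval [:: (v, y)] phi).
  by rewrite /tensor_eval !big_seq1; exact: linearPl.
change (tensor_eval [:: (x, a *: u + v)] phi =
  a *: tensor_eval [:: (x, u)] phi + tensor_eval [:: (x, v)] phi).
by rewrite /tensor_eval !big_seq1; exact: linearPr.
Qed.

HB.instance Definition _ := bilinear_isBilinear.Build K X Y ptensor *:%R *:%R
  ptensor_map ptensor_map_bilinear.

Lemma ptensor_map_sum s phi : \val (\sum_(p <- s) ptensor_map p.1 p.2) phi = tensor_eval s phi.
Proof.
elim: s => [|p s IHs]; first by rewrite /tensor_eval !big_nil raddf0.
rewrite big_cons raddfD -cat1s tensor_eval_cat -IHs; congr (_ + _).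
by case: p.
Qed.

Lemma ptensor_projective :
  projective_tensor_product (ptensor_map : {bilinear X -> Y -> ptensor}).
Proof.
split=> [s|].
  suff -> : [set `|\sum_(p <- s) phi p.1 p.2| |
      phi in @bilinear_norm_le1 K X Y] =
      range (fun phi => `|\val (\sum_(p <- s) ptensor_map p.1 p.2) phi|).
    exact: ptensor_norm_supremums.
  apply/seteqP; split => [_ [phi phi1 <-]|_ [phi _ <-]].
    by exists (exist _ phi phi1) => //; rewrite ptensor_map_sum.
  by exists (sval phi); [exact: svalP|rewrite ptensor_map_sum].
move=> O [F OF]; rewrite openE => /(_ _ OF).
rewrite /interior -nbhs_ballE => -[e /= e0 eO].
have /asboolP/(_ _ (divr_gt0 e0 (@ltr0Sn K 1)))[s sP] := valP F.
exists (\sum_(p <- s) ptensor_map p.1 p.2); split; last by exists s.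
apply: eO; rewrite -ball_normE /=.
have : `|F - \sum_(p <- s) ptensor_map p.1 p.2| <= e / 2.
  by apply: ptensor_norm_le => phi; have := sP phi; rewrite -ptensor_map_sum raddfB.
by move=> /le_lt_trans; apply; rewrite ltr_pdivrMr// ltr_pMr// ltr1n.
Qed.

End Existence.

Lemma real_nonneg_lub (R : realType) : nonneg_lub R.
Proof.
move=> A A0 _ Ab; exists (sup A); split.
  by move=> a; apply: sup_upper_bound.
by move=> u ?; apply: ge_sup.
Qed.

Lemma real_filter_complete (R : realType) : filter_complete R.
Proof. by move=> F FF; exact: R_complete. Qed.

Lemma complex_nonneg_lub (R : realType) : nonneg_lub R[i].
Proof.
move=> A A0 A_ge0 [u uA].
pose B := [set complex.Re a | a in A].
have ReA a : A a -> a = (complex.Re a)%:C%C.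
  by move=> /A_ge0; case: a => a b; rewrite lecE/= => /andP[/eqP->].
have supB : has_sup B.
  split; first by case: A0 => a Aa; exists (complex.Re a), a.
  exists (complex.Re u) => _ [a Aa <-].
  by move: (uA _ Aa); rewrite lecE => /andP[].
exists (sup B)%:C%C; split.
  move=> a Aa; rewrite (ReA _ Aa) lecR; apply: sup_upper_bound => //.
  by exists a.
move=> v vA; have [a Aa] := A0.
have : complex.Im v = 0.
  by move: (vA _ Aa); rewrite lecE (ReA _ Aa)/= => /andP[/eqP].
case: v vA => v w vA /= w0; rewrite w0 in vA *; rewrite lecR.
apply: ge_sup; first by case: supB.
move=> _ [b Ab <-].
by move: (vA _ Ab); rewrite lecE => /andP[].
Qed.

Lemma complex_filter_complete (R : realType) : filter_complete R[i].
Proof.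
move=> F FF /cauchy_ballP Fc.
have part (f : R[i] -> R) :
    (forall x y, f (x - y) = f x - f y) -> (forall x, `|f x|%:C%C <= `|x|) ->
    cvg ((fun z : R[i]^o => f z : R) @ F).
  move=> fB fle; apply: R_complete; apply/cauchy_ballP => e e0.
  have e0C : 0 < (e%:C%C : R[i]) by rewrite ltcR.
  have := Fc _ e0C; rewrite !near_simpl => H.
  rewrite near_map2; apply: filterS H => -[x y] /=.
  rewrite -!ball_normE /= => H; rewrite -ltcR; apply: le_lt_trans H.
  by rewrite -fB; exact: fle.
have Re_B (x y : R[i]) : complex.Re (x - y) = complex.Re x - complex.Re y.
  by case: x y => ? ? [].
have Im_B (x y : R[i]) : complex.Im (x - y) = complex.Im x - complex.Im y.
  by case: x y => ? ? [].
have cRe := part (@complex.Re R) Re_B (@normc_ge_Re R).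
have Im_le (x : R[i]) : `|complex.Im x|%:C%C <= `|x|.
  case: x => x y; rewrite normc_def lecR/= -sqrtr_sqr ler_wsqrtr//.
  by rewrite lerDr sqr_ge0.
have cIm := part (@complex.Im R) Im_B Im_le.
set a := lim _ in cRe; set b := lim _ in cIm.
apply/cvg_ex; exists (a +i* b)%C; apply/cvgrPdist_le => e e0.
have eE : e = (complex.Re e)%:C%C.
  by move: e0; case: e => x y; rewrite ltcE/= => /andP[/eqP->].
have r0 : 0 < complex.Re e / 2 by rewrite divr_gt0// -ltcR -eE.
move/cvgrPdist_le : cRe => /(_ _ r0) HRe.
move/cvgrPdist_le : cIm => /(_ _ r0) HIm.
have K1 : F [set z | `|a - complex.Re z| <= complex.Re e / 2] by exact: HRe.
have K2 : F [set z | `|b - complex.Im z| <= complex.Re e / 2] by exact: HIm.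
suff : F [set z : R[i] | `|(a +i* b)%C - z| <= e] by exact.
apply: filterS2 K1 K2 => z /= zRe zIm.
rewrite [_ - _]complexE; apply: le_trans (ler_normD _ _) _.
rewrite Re_B Im_B normrM !normc_def /= expr0n/= expr1n !addr0 add0r sqrtr1 mul1r.
by rewrite eE -rmorphD lecR (splitr (complex.Re e)) !sqrtr_sqr lerD.
Qed.

Lemma real_projective_tensor_product_exists (R : realType)
    (X Y : normedModType R) :
  exists (Z : completeNormedModType R) (t : {bilinear X -> Y -> Z}),
    projective_tensor_product t.
Proof.
eexists; eexists.
exact: (ptensor_projective (@real_nonneg_lub R) (@real_filter_complete R)).
Qed.

Lemma complex_projective_tensor_product_exists (R : realType)
    (X Y : normedModType R[i]) :
  exists (Z : completeNormedModType R[i]) (t : {bilinear X -> Y -> Z}),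
    projective_tensor_product t.
Proof.
eexists; eexists.
exact: (ptensor_projective (@complex_nonneg_lub R) (@complex_filter_complete R)).
Qed.

(* Main.v *)
Require Import Defs.
From HB Require Import structures.
From mathcomp Require Import all_boot all_order all_algebra.
From mathcomp Require Import sesquilinear complex.
From mathcomp Require Import all_classical all_reals topology normedtype sequences.
From mathcomp Require Import ring.

(** Both scalar fields are treated at once. Write E for the tensor square of c0,
    F for the tensor product of E with c0, and suppose that T : F -> E is linear,
    bounded, and bounded below. The two spaces differ in how fast sums over a
    weakly null family that is spread out fast enough can grow: like n in F, but
    only like a power of n with exponent log 2 / log 3 in E.

    In F: let h_1, ..., h_n be Rademacher functions on D points, viewed as vectors
    of c0. By Bessel's inequality and Cauchy-Schwarz, for scalars theta_k of
    modulus at most 1 the form sum_k theta_k u^(k) v^(k), where u^(k) is the k-th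
    Rademacher coefficient of u, has norm at most 1 on c0 x c0. So the tensors
    w_k = h_k (x) h_k have norm at most 1, and there are functionals psi_k on E with
    psi_k(w_k) = 1 whose signed sums all have norm at most 1. The form that sends (z, x) to
    sum_k x_(m_k) psi_k(z) then has norm at most 1 on E x c0, and it shows that
    sum_k w_k (x) e_(m_k) has norm at least n for all distinct indices m_k
    ([ell1_tensors]).

    In E: for fixed k the sums of T (w_k (x) e_m) over m with signs are bounded,
    so coordinatewise these vectors tend to 0 as m grows. Hence the m_k and
    cutoffs N_0 <= N_1 <= ... can be chosen in turn so that T (w_k (x) e_(m_k)) is,
    up to a small error, supported in [0, N_(k+1))^2 outside [0, N_k)^2
    ([weakly_null_block]). With I_k = [N_k, N_(k+1)) this L-shaped region is the
    union of [0, N_k) x I_k and I_k x [0, N_(k+1)), so a form of norm 1 meets the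
    k-th vector only through its k-th block of columns and its k-th block of rows.
    The norms of n = 3 ^ s disjoint column blocks of a form of norm 1 add up to at
    most 2 ^ s ([column_blocks]). This is a weak form of the cotype 2 property of
    l1, enough here and proved by iterating Hlawka's inequality over groups of
    three blocks. The sum over k therefore has norm at most 3 ^ s times a small
    constant plus a multiple of 2 ^ s ([block_sum_le], [image_upper_estimate]),
    while T bounded below forces it to be at least a fixed multiple of 3 ^ s. *)

Set Implicit Arguments.
Unset Strict Implicit.
Unset Printing Implicit Defensive.

Import Order.TTheory GRing.Theory Num.Theory.
Import numFieldNormedType.Exports.

Local Open Scope classical_set_scope.
Local Open Scope ring_scope.

(** * Inequalities for real and complex scalars *)

(** All that the argument needs from the scalars. The quadratic identity is the
    Jordan-von Neumann form of the statement that the modulus is Euclidean; it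
    contains the parallelogram law and gives Hlawka's inequality. *)
Record real_or_complex (K : numFieldType) : Prop := RealOrComplex {
  norm_quadratic : forall a b c : K,
    `|a| ^+ 2 + `|b| ^+ 2 + `|c| ^+ 2 + `|a + b + c| ^+ 2 =
    `|a + b| ^+ 2 + `|b + c| ^+ 2 + `|c + a| ^+ 2 ;
  scalar_archimedean : forall x : K, 0 <= x -> exists n : nat, x < n%:R ;
  scalar_lub : nonneg_lub K ;
  scalar_complete : filter_complete K }.

Lemma real_real_or_complex (R : realType) : real_or_complex R.
Proof.
split; [|by move=> x /archi_boundP; eexists; eassumption|..].
- by move=> a b c; rewrite !real_normK ?num_real//; ring.
- exact: real_nonneg_lub.
- exact: real_filter_complete.
Qed.

Lemma complex_real_or_complex (R : realType) : real_or_complex R[i].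
Proof.
split.
- by move=> a b c; rewrite !normCK !rmorphD; ring.
- case=> x y; rewrite lecE/= => /andP[/eqP-> /archi_boundP xn].
  by exists (Num.bound x); rewrite -(rmorph_nat (real_complex R)) ltcR.
- exact: complex_nonneg_lub.
- exact: complex_filter_complete.
Qed.

Section ScalarInequalities.
Context (K : numFieldType) (rcK : real_or_complex K).

Lemma parallelogram (a b : K) :
  `|a + b| ^+ 2 + `|a - b| ^+ 2 = 2 * (`|a| ^+ 2 + `|b| ^+ 2).
Proof.
have := norm_quadratic rcK a b (- b).
rewrite addrK subrr normr0 normrN (addrC (- b) a) expr0n addr0 => H.
by rewrite -H; ring.
Qed.

Lemma sqr_normD_le (a b : K) : `|a + b| ^+ 2 <= 2 * (`|a| ^+ 2 + `|b| ^+ 2).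
Proof. by rewrite -parallelogram lerDl exprn_ge0. Qed.

(** Multiplying the difference of the two sides by the right-hand side turns it,
    by the quadratic identity, into a sum of products of triangle defects. *)
Lemma hlawka (a b c : K) :
  `|a + b| + `|b + c| + `|c + a| <= `|a| + `|b| + `|c| + `|a + b + c|.
Proof.
set P := leRHS; set Q := leLHS.
have [P0|P_neq0] := eqVneq P 0.
  have /eqP := P0; rewrite /P !paddr_eq0 ?addr_ge0// !normr_eq0.
  move=> /andP[/andP[/andP[/eqP a0 /eqP b0] /eqP c0] _].
  by rewrite /Q a0 b0 c0 !addr0 normr0 !addr0.
have P_gt0 : 0 < P by rewrite lt_def P_neq0 /P !addr_ge0.
rewrite -subr_ge0 -(pmulr_lge0 _ P_gt0).
suff -> : (P - Q) * P =
    (`|b| + `|c| - `|b + c|) * (`|a| + `|a + b + c| - `|b + c|) +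
    (`|c| + `|a| - `|c + a|) * (`|b| + `|a + b + c| - `|c + a|) +
    (`|a| + `|b| - `|a + b|) * (`|c| + `|a + b + c| - `|a + b|).
  have tri2 x y z : x + y = - z + (a + b + c) -> `|x + y| <= `|z| + `|a + b + c|.
    by move=> ->; rewrite -[`|z|]normrN ler_normD.
  by rewrite !addr_ge0// mulr_ge0// subr_ge0 ?ler_normD// tri2//; ring.
rewrite -[RHS](addrK (`|a| ^+ 2 + `|b| ^+ 2 + `|c| ^+ 2 + `|a + b + c| ^+ 2)).
by rewrite {2}(norm_quadratic rcK) /P /Q; ring.
Qed.

(** Hlawka's inequality for the three sums that carry one minus sign: on average
    over the signs, the modulus of a signed sum is at least half of the total of
    the moduli, whereas the triangle inequality alone would only give a third. *)
Lemma sign_average3 (b1 b2 b3 : K) :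
  2 * (`|b1| + `|b2| + `|b3|) <=
  `|b1 + b2 + b3| + `|- b1 + b2 + b3| + `|b1 - b2 + b3| + `|b1 + b2 - b3|.
Proof.
have := hlawka (- b1 + b2 + b3) (b1 - b2 + b3) (b1 + b2 - b3).
have -> : - b1 + b2 + b3 + (b1 - b2 + b3) = 2 * b3 by ring.
have -> : b1 - b2 + b3 + (b1 + b2 - b3) = 2 * b1 by ring.
have -> : b1 + b2 - b3 + (- b1 + b2 + b3) = 2 * b2 by ring.
have -> : 2 * b3 + (b1 + b2 - b3) = b1 + b2 + b3 by ring.
rewrite !normrM (ger0_norm (ler0n K 2)) => H.
apply: le_trans (le_trans _ H) _; rewrite le_eqVlt; apply/orP; left; apply/eqP; ring.
Qed.

End ScalarInequalities.

(** * Rademacher functions and Bessel's inequality *)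

Section OrthogonalSigns.
Context (K : numFieldType) (rcK : real_or_complex K).

(** Rademacher functions on a set of 2 ^ n points with Bessel's inequality.
    Doubling the set of points adds one function, and the parallelogram law
    carries the inequality over. The coefficient of the new function is half the
    difference of the means over the two copies, so the induction needs the
    constant function in the inequality as well. *)
Lemma rademacher (n : nat) : exists (D : nat) (h : nat -> nat -> K),
  [/\ (0 < D)%N, forall k i, `|h k i| <= 1,
      forall k, (k < n)%N -> \sum_(i < D) h k i * h k i = D%:R &
      forall u : nat -> K,
        `|\sum_(i < D) u i| ^+ 2 + \sum_(k < n) `|\sum_(i < D) u i * h k i| ^+ 2
        <= D%:R * \sum_(i < D) `|u i| ^+ 2].
Proof.
elim: n => [|n [D [h [D0 h1 hh bessel]]]].
  exists 1%N, (fun _ _ => 1); split=> [//|k i|//|u]; first by rewrite normr1.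
  by rewrite big_ord0 !big_ord1 addr0 mul1r.
pose g k i := if (k < n)%N then h k (if (i < D)%N then i else (i - D)%N)
              else if (i < D)%N then 1 else -1.
have split_sum (f : nat -> K) : \sum_(i < D + D) f i =
    \sum_(i < D) f i + \sum_(i < D) f (D + i)%N by rewrite big_split_ord.
have gl k i : (k < n)%N -> (i < D)%N -> g k i = h k i by rewrite /g => -> ->.
have gr k i : (k < n)%N -> g k (D + i)%N = h k i.
  by rewrite /g => ->; rewrite ltnNge leq_addr addKn.
have gnl i : (i < D)%N -> g n i = 1 by rewrite /g ltnn => ->.
have gnr i : g n (D + i)%N = -1 by rewrite /g ltnn ltnNge leq_addr.
exists (D + D)%N, g; split.
- by rewrite addn_gt0 D0.
- by move=> k i; rewrite /g; case: ifP => // _; case: ifP; rewrite ?normrN normr1.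
- move=> k; rewrite ltnS leq_eqVlt => /predU1P[->|kn].
    rewrite (split_sum (fun i => g n i * g n i)) natrD; congr (_ + _);
      rewrite -[D in RHS]card_ord -sumr_const; apply: eq_bigr => i _.
      by rewrite gnl// mulr1.
    by rewrite gnr mulrNN mulr1.
  rewrite (split_sum (fun i => g k i * g k i)) natrD; congr (_ + _); rewrite -[RHS](hh _ kn);
    apply: eq_bigr => i _; first by rewrite gl.
  by rewrite gr.
move=> u; rewrite big_ord_recr/=.
rewrite (split_sum u) (split_sum (fun i => u i * g n i)) (split_sum (fun i => `|u i| ^+ 2)).
under [\sum_(i < D) u i * g n i]eq_bigr => i _ do rewrite gnl// mulr1.
under [\sum_(i < D) u (D + i)%N * g n _]eq_bigr => i _ do rewrite gnr mulrN1.
rewrite sumrN addrCA addrC parallelogram//.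
have step : \sum_(k < n) `|\sum_(i < D + D) u i * g k i| ^+ 2 <=
    2 * \sum_(k < n) (`|\sum_(i < D) u i * h k i| ^+ 2 +
                      `|\sum_(i < D) u (D + i)%N * h k i| ^+ 2).
  rewrite mulr_sumr; apply: ler_sum => k _.
  rewrite (split_sum (fun i => u i * g k i)).
  under eq_bigr => i _ do rewrite gl//.
  under [X in `|_ + X|]eq_bigr => i _ do rewrite gr//.
  exact: sqr_normD_le.
apply: le_trans (lerD (lexx _) step) _ => {step}.
rewrite big_split/= -mulrDr addrACA.
have -> : (D + D)%:R = 2 * D%:R :> K by rewrite natrD mulr_natl mulr2n.
rewrite -mulrA (mulrDr D%:R) ler_pM2l ?ltr0n//.
by apply: lerD; [exact: bessel|exact: (bessel (fun i => u (D + i)%N))].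
Qed.

(** Cauchy-Schwarz applied to Bessel's inequality: bounded multiples of the
    products of coefficients add up to a bounded bilinear form. *)
Lemma bessel_product (n D : nat) (h : nat -> nat -> K) (theta u v : nat -> K)
    (Theta A B : K) :
  (forall u : nat -> K, \sum_(k < n) `|\sum_(i < D) u i * h k i| ^+ 2
     <= D%:R * \sum_(i < D) `|u i| ^+ 2) ->
  (forall k, `|theta k| <= Theta) -> (forall i, `|u i| <= A) ->
  (forall i, `|v i| <= B) ->
  `|\sum_(k < n) theta k * ((\sum_(i < D) u i * h k i) * (\sum_(i < D) v i * h k i))|
    <= Theta * (A * B * D%:R ^+ 2).
Proof.
move=> bessel thetaP uA vB.
have A0 : 0 <= A := le_trans (normr_ge0 _) (uA 0%N).
have B0 : 0 <= B := le_trans (normr_ge0 _) (vB 0%N).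
have T0 : 0 <= Theta := le_trans (normr_ge0 _) (thetaP 0%N).
set U := fun k : 'I_n => \sum_(i < D) u i * h k i.
set V := fun k : 'I_n => \sum_(i < D) v i * h k i.
apply: (@le_trans _ _ (Theta * \sum_(k < n) `|U k| * `|V k|)).
  rewrite mulr_sumr; apply: le_trans (ler_norm_sum _ _ _) _.
  by apply: ler_sum => k _; rewrite !normrM ler_wpM2r ?mulr_ge0.
apply: ler_wpM2l => //.
have sq (w : nat -> K) (M : K) : (forall i, `|w i| <= M) ->
    \sum_(k < n) `|\sum_(i < D) w i * h k i| ^+ 2 <= (M * D%:R) ^+ 2.
  move=> wM; apply: le_trans (bessel w) _.
  rewrite exprMn mulrC expr2 mulrA ler_wpM2r ?ler0n//.
  apply: (@le_trans _ _ (\sum_(i < D) M ^+ 2)).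
    by apply: ler_sum => i _; rewrite lerXn2r ?nnegrE ?(le_trans (normr_ge0 _) (wM 0%N)).
  by rewrite sumr_const card_ord expr2 mulr_natr.
have zero (w : nat -> K) k : (forall i, `|w i| <= 0) -> \sum_(i < D) w i * h k i = 0.
  by move=> w0; apply: big1 => i _; move: (w0 i); rewrite normr_le0 => /eqP->; rewrite mul0r.
have [A_eq0|A_neq0] := eqVneq A 0.
  rewrite big1 ?A_eq0 ?mul0r// => k _.
  by rewrite /U zero ?normr0 ?mul0r// -A_eq0.
have [B_eq0|B_neq0] := eqVneq B 0.
  rewrite big1 ?B_eq0 ?mulr0 ?mul0r// => k _.
  by rewrite /V zero ?normr0 ?mulr0// -B_eq0.
(* Twice A * B times a product of coefficients is bounded by the
   arithmetic-geometric mean inequality, and Bessel applies to each square. *)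
have AB0 : 0 < 2 * (A * B) by rewrite !mulr_gt0// lt_def ?A_neq0 ?B_neq0.
rewrite -(ler_pM2l AB0) mulr_sumr.
apply: (@le_trans _ _ (\sum_(k < n) (B ^+ 2 * `|U k| ^+ 2 + A ^+ 2 * `|V k| ^+ 2))).
  apply: ler_sum => k _; rewrite -subr_ge0.
  have -> : B ^+ 2 * `|U k| ^+ 2 + A ^+ 2 * `|V k| ^+ 2 - 2 * (A * B) * (`|U k| * `|V k|)
    = (B * `|U k| - A * `|V k|) ^+ 2 by ring.
  by rewrite real_exprn_even_ge0// realB// realM// ger0_real.
rewrite big_split/= -!mulr_sumr.
apply: le_trans (lerD (ler_wpM2l _ (sq u A uA)) (ler_wpM2l _ (sq v B vB))) _;
  rewrite ?exprn_ge0// le_eqVlt; apply/orP; left; apply/eqP; ring.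
Qed.

End OrthogonalSigns.

(** * Projective tensor products and extension of bounded forms *)

Section BilinearPacking.
Context (K : numFieldType) (X Y : lmodType K) (f : X -> Y -> K^o).
Hypothesis f_bilinear : bilinear_for *:%R *:%R f.

(** Carries the proof of bilinearity as an argument, so that the structure can be
    attached to a function that is only known to be bilinear inside a proof. *)
Definition pack_bilinear of bilinear_for *:%R *:%R f := f.

HB.instance Definition _ := bilinear_isBilinear.Build K X Y K^o *:%R *:%R
  (pack_bilinear f_bilinear) f_bilinear.

Lemma bilinear_of : exists g : {bilinear X -> Y -> K^o}, forall x y, g x y = f x y.
Proof. by exists (pack_bilinear f_bilinear : {bilinear X -> Y -> K^o}). Qed.

End BilinearPacking.

Section LinearPacking.
Context (K : numFieldType) (Z : lmodType K) (f : Z -> K^o).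
Hypothesis f_linear : linear f.

Definition pack_linear of linear f := f.

HB.instance Definition _ := GRing.isLinear.Build K Z K^o *:%R
  (pack_linear f_linear) f_linear.

Lemma linear_of : exists g : {linear Z -> K^o}, forall z, g z = f z.
Proof. by exists (pack_linear f_linear : {linear Z -> K^o}). Qed.

End LinearPacking.

Definition form_bound (K : numFieldType) (X Y : normedModType K)
  (f : X -> Y -> K^o) (M : K) := forall x y, `|f x y| <= M * (`|x| * `|y|).

Section TensorProduct.
Context (K : numFieldType) (complK : filter_complete K).
Context (X Y : normedModType K) (Z : completeNormedModType K).
Context (t : {bilinear X -> Y -> Z}) (tP : projective_tensor_product t).

Local Notation tau s := (\sum_(p <- s) t p.1 p.2).
Local Notation ev f s := (\sum_(p <- s) f p.1 p.2).

Lemma form_tensor_le (f : {bilinear X -> Y -> K^o}) (M : K) (s : seq (X * Y)) :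
  0 <= M -> form_bound f M -> `|ev f s| <= M * `|tau s|.
Proof.
rewrite le_eqVlt => /predU1P[<-|M_gt0] fM.
  rewrite mul0r big1 ?normr0// => p _; apply/eqP.
  by rewrite -normr_le0; have := fM p.1 p.2; rewrite mul0r.
have [g gE] : exists g : {bilinear X -> Y -> K^o}, forall x y, g x y = M^-1 * f x y.
  apply: (@bilinear_of K X Y (fun x y => M^-1 * f x y)); split=> [y|x] a u v /=.
    by rewrite linearPl mulrDr /= mulrCA.
  by rewrite linearPr mulrDr /= mulrCA.
have [+ _] := projective_tensor_norm tP s.
have Mi0 : 0 <= M^-1 by rewrite invr_ge0 ltW.
move=> /(_ `|ev g s|) H; rewrite -ler_pdivrMl//.
have -> : M^-1 * `|ev f s| = `|ev g s|.
  rewrite -[X in X * _]ger0_norm// -normrM mulr_sumr.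
  by under eq_bigr do rewrite -gE.
apply: H; exists g => // x y; rewrite gE normrM ger0_norm//.
by apply: le_trans (ler_wpM2l Mi0 (fM x y)) _; rewrite mulKf// gt_eqF.
Qed.

Lemma tensor_norm_le (s : seq (X * Y)) (B : K) :
  (forall f : {bilinear X -> Y -> K^o}, form_bound f 1 -> `|ev f s| <= B) ->
  `|tau s| <= B.
Proof.
move=> H; have [_] := projective_tensor_norm tP s; apply=> _ [f f1 <-].
by apply: H => x y; rewrite mul1r.
Qed.

Lemma tensor_map_le x y : `|t x y| <= `|x| * `|y|.
Proof.
have := @tensor_norm_le [:: (x, y)] (`|x| * `|y|); rewrite big_seq1; apply => f f1.
by rewrite big_seq1 -[leRHS]mul1r.
Qed.

Lemma tensor_approx (z : Z) (e : K) : 0 < e -> exists s, `|z - tau s| < e.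
Proof.
move=> e0; have [] := projective_tensor_dense tP (O := ball z e).
- by exists z; exact: ballxx.
- exact: ball_open.
- by move=> w [zw [s _ sw]]; exists s; move: zw; rewrite -sw -ball_normE.
Qed.

Lemma sum_cat_scale (V : lmodType K) (f : {bilinear X -> Y -> V}) (a : K) s1 s2 :
  ev f ([seq (a *: p.1, p.2) | p <- s1] ++ s2) = a *: (ev f s1) + ev f s2.
Proof.
rewrite big_cat/= big_map scaler_sumr; congr (_ + _).
by apply: eq_bigr => p _; rewrite linearZl_LR.
Qed.

(** By density, the norm of the functional induced by a form is controlled by any
    bound of the form, however crude the bound known beforehand. *)
Lemma linear_extension_bound (f : {bilinear X -> Y -> K^o}) (psi : {linear Z -> K^o})
    (M B : K) : 0 <= M -> 0 <= B -> form_bound f M ->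
  (forall x y, psi (t x y) = f x y) -> (forall z, `|psi z| <= B * `|z|) ->
  forall z, `|psi z| <= M * `|z|.
Proof.
move=> M0 B0 fM psif psiB z; apply/ler_addgt0Pr => e e0.
have MB0 : 0 < M + B + 1 by rewrite ltr_wpDl ?addr_ge0.
have [s zs] := tensor_approx z (divr_gt0 e0 MB0).
rewrite -[psi z](subrK (psi (tau s))) -linearB.
have -> : psi (tau s) = ev f s by rewrite linear_sum; apply: eq_bigr => p _.
apply: le_trans (ler_normD _ _) _.
apply: le_trans (lerD (psiB _) (form_tensor_le s M0 fM)) _.
have : `|tau s| <= `|z| + `|z - tau s|.
  by rewrite -{1}[tau s](subKr z) (le_trans (ler_normB _ _)).
move=> /(ler_wpM2l M0)/(lerD (lexx (B * `|z - tau s|)))/le_trans; apply.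
rewrite mulrDr addrCA lerD2l -mulrDl (addrC B).
apply: le_trans (_ : (M + B + 1) * `|z - tau s| <= _).
  by rewrite ler_wpM2r// lerDl.
by rewrite mulrC -ler_pdivlMr// ltW.
Qed.

(** The universal property of the completed tensor product, for scalar forms:
    a bounded form is uniformly continuous on the dense set of finite sums. *)
Lemma linear_extension (f : {bilinear X -> Y -> K^o}) (M : K) :
  0 <= M -> form_bound f M ->
  exists psi : {linear Z -> K^o},
    (forall x y, psi (t x y) = f x y) /\ (forall z, `|psi z| <= M * `|z|).
Proof.
move=> M0 fM.
have f_lip s1 s2 : `|ev f s1 - ev f s2| <= M * `|tau s1 - tau s2|.
  have E (V : lmodType K) (g : {bilinear X -> Y -> V}) : ev g s1 - ev g s2 =
      ev g ([seq (-1 *: p.1, p.2) | p <- s2] ++ s1).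
    by rewrite sum_cat_scale scaleN1r addrC.
  by rewrite !E; exact: form_tensor_le.
(* The value at z is the only scalar at distance at most M times the distance
   from z to each finite sum; it is the limit along the finite sums near z. *)
pose ext z (c : K^o) := forall s, `|c - ev f s| <= M * `|z - tau s|.
have ext_ex z : exists c, ext z c.
  pose F : set_system K^o := filter_from [set e : K | 0 < e]
    (fun e => [set ev f s | s in [set s | `|z - tau s| < e]]).
  have FF : ProperFilter F.
    apply: filter_from_proper; last first.
      move=> e e0; have [s zs] := tensor_approx z e0.
      by exists (ev f s); exists s.
    apply: filter_from_filter; first by exists 1; exact: ltr01.
    move=> e1 e2 e10 e20.
    have /orP[le12|le21] := real_leVge (gtr0_real e10) (gtr0_real e20).
      exists e1 => // _ [s /= zs <-]; split; exists s => //=.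
      exact: lt_le_trans le12.
    exists e2 => // _ [s /= zs <-]; split; exists s => //=.
    exact: lt_le_trans le21.
  have /complK/cvg_ex[c Fc] : cauchy F.
    apply: cauchy_exP => e e0.
    have M1 : 0 < M + 1 by rewrite ltr_wpDl.
    have e1 : 0 < e / (M + 1) / 2 by rewrite !divr_gt0.
    have [s0 zs0] := tensor_approx z e1.
    exists (ev f s0); exists (e / (M + 1) / 2) => // _ [s /= zs <-].
    rewrite -ball_normE /=; apply: le_lt_trans (f_lip _ _) _.
    have ss : `|tau s0 - tau s| < e / (M + 1).
      apply: le_lt_trans (ler_distD z _ _) _; rewrite [ltRHS]splitr.
      by rewrite ltrD// distrC.
    apply: le_lt_trans (_ : (M + 1) * `|tau s0 - tau s| < e).
      by rewrite ler_wpM2r// lerDl.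
    by rewrite mulrC -ltr_pdivlMr.
  exists c => s; apply/ler_addgt0Pr => e e0.
  have M1 : 0 < M + 1 by rewrite ltr_wpDl.
  have e2 : 0 < e / 2 by rewrite divr_gt0.
  have e1 : 0 < e / (M + 1) / 2 by rewrite !divr_gt0.
  have [d d0 dP] := Fc _ (nbhsx_ballx c _ e2).
  have [s' zs'] : exists s', `|z - tau s'| < d /\ `|z - tau s'| < e / (M + 1) / 2.
    have /orP[le12|le21] := real_leVge (gtr0_real d0) (gtr0_real e1).
      have [s' zs'] := tensor_approx z d0; exists s'; split=> //.
      exact: lt_le_trans le12.
    have [s' zs'] := tensor_approx z e1; exists s'; split=> //.
    exact: lt_le_trans le21.
  have cs' : `|c - ev f s'| < e / 2.
    have : ball c (e / 2) (ev f s') by apply: dP; exists s' => //; case: zs'.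
    by rewrite -ball_normE.
  rewrite -(subrK (ev f s') c) -addrA.
  apply: le_trans (ler_normD _ _) _.
  rewrite (splitr e) addrA [leLHS]addrC; apply: lerD; last exact: ltW.
  apply: le_trans (f_lip _ _) _.
  have : `|tau s' - tau s| <= `|z - tau s| + `|z - tau s'|.
    by rewrite [leRHS]addrC (distrC z (tau s')); exact: ler_distD.
  move=> /(ler_wpM2l M0)/le_trans; apply; rewrite mulrDr lerD2l.
  apply: le_trans (_ : (M + 1) * `|z - tau s'| <= _).
    by rewrite ler_wpM2r// lerDl.
  rewrite mulrC -ler_pdivlMr// -mulrA (mulrC 2^-1) mulrA ltW//.
  by case: zs'.
have ext_uniq z c d Q : 0 <= Q -> ext z c ->
    (forall e, 0 < e -> exists s, `|z - tau s| <= Q * e /\ `|d - ev f s| <= Q * e) ->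
    c = d.
  move=> Q0 zc zd; apply/eqP; rewrite -subr_eq0 -normr_le0; apply/ler_addgt0Pr => e e0.
  have MQ1 : 0 < M * Q + Q + 1 by rewrite ltr_wpDl// addr_ge0// mulr_ge0.
  rewrite add0r; have [s [zs ds]] := zd _ (divr_gt0 e0 MQ1).
  rewrite -(subrK (ev f s) c) -addrA; apply: le_trans (ler_normD _ _) _.
  rewrite [`|_ - d|]distrC; apply: le_trans (lerD (zc s) ds) _.
  apply: le_trans (lerD (ler_wpM2l M0 zs) (lexx _)) _.
  rewrite mulrA -mulrDl mulrA ler_pdivrMr// mulrC ler_wpM2l ?(ltW e0)//.
  by rewrite lerDl.
pose psi z := xget 0 (ext z).
have psiP z : ext z (psi z) by apply: xgetPex; exact: ext_ex.
have psi_tau s : psi (tau s) = ev f s.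
  apply: (ext_uniq _ _ _ 0 _ (psiP _)) => // e e0.
  by exists s; rewrite !subrr !normr0 mul0r.
have psi_lin : linear (psi : Z -> K^o).
  move=> a z1 z2; have M1 : 0 <= M + 1 by rewrite addr_ge0.
  have a1 : 0 <= `|a| + 1 by rewrite addr_ge0.
  apply: (ext_uniq _ _ _ ((`|a| + 1) * (M + 1)) _ (psiP _)); first exact: mulr_ge0.
  move=> e e0.
  have [s1 /ltW zs1] := tensor_approx z1 e0; have [s2 /ltW zs2] := tensor_approx z2 e0.
  exists ([seq (a *: p.1, p.2) | p <- s1] ++ s2); rewrite !sum_cat_scale.
  have comb (V : normedModType K) (u1 u2 v1 v2 : V) (q : K) :
      `|u1 - v1| <= q -> `|u2 - v2| <= q ->
      `|a *: u1 + u2 - (a *: v1 + v2)| <= (`|a| + 1) * q.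
    move=> h1 h2; rewrite opprD addrACA -scalerBr mulrDl mul1r.
    apply: le_trans (ler_normD _ _) (lerD _ h2).
    by rewrite normrZ ler_wpM2l.
  rewrite -mulrA; split.
    apply: le_trans (comb _ _ _ _ _ _ zs1 zs2) _; rewrite ler_wpM2l//.
    by rewrite -[leLHS]mul1r ler_wpM2r ?(ltW e0)// lerDr.
  apply: comb; first apply: le_trans (psiP _ _) _.
    by apply: ler_pM => //; rewrite ?lerDl.
  apply: le_trans (psiP _ _) _.
  by apply: ler_pM => //; rewrite ?lerDl.
have [Psi PsiE] := linear_of psi_lin.
exists Psi; split=> [x y|z]; rewrite PsiE.
  by have := psi_tau [:: (x, y)]; rewrite !big_seq1.
by have := psiP z [::]; rewrite !big_nil !subr0.
Qed.

End TensorProduct.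

(** * Coordinate blocks in c0 and column blocks of forms *)

Section NullSequenceBlocks.
Context (K : numFieldType).
Implicit Types (x y : c0 K) (A B : pred nat).

Lemma restr_subproof A x : (fun n => if A n then val x n else 0 : K^o) \in (@null_seq K).
Proof.
apply/null_seqP/cvgrPdist_lt => e e0.
have /null_seqP/cvgrPdist_lt/(_ _ e0) := valP x; apply: filterS => n.
by case: (A n) => //= _; rewrite subrr normr0.
Qed.

Definition restr A x : c0 K := exist (fun s : nat -> K^o => s \in @null_seq K) _ (restr_subproof A x).

Lemma restrE A x n : val (restr A x) n = if A n then val x n else 0.
Proof. by []. Qed.

Lemma c0_ext x y : (forall n, val x n = val y n) -> x = y.
Proof. by move=> xy; apply/val_inj/funext. Qed.

Lemma valD x y n : val (x + y) n = val x n + val y n.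
Proof. by rewrite raddfD. Qed.

Lemma valB x y n : val (x - y) n = val x n - val y n.
Proof. by rewrite raddfB. Qed.

Lemma valN x n : val (- x) n = - val x n.
Proof. by rewrite raddfN. Qed.

Lemma valZ a x n : val (a *: x) n = a * val x n.
Proof. by rewrite linearZ. Qed.

Lemma val_sum (I : Type) (r : seq I) (P : pred I) (F : I -> c0 K) n :
  val (\sum_(i <- r | P i) F i) n = \sum_(i <- r | P i) val (F i) n.
Proof.
elim/big_rec2 : _ => [|i b c _ <-]; first by rewrite raddf0.
by rewrite valD.
Qed.

Lemma restrP A a x y : restr A (a *: x + y) = a *: restr A x + restr A y.
Proof.
apply: c0_ext => n; rewrite restrE !valD !valZ !restrE.
by case: (A n); rewrite // mulr0 addr0.
Qed.

Lemma c0_norm_leP x (M : K) : (forall n, `|val x n| <= M) -> `|x| <= M.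
Proof. exact: c0_norm_le. Qed.

Lemma c0_coord_le x n : `|val x n| <= `|x|.
Proof. exact: c0_norm_ge. Qed.

Lemma restr_norm A x : `|restr A x| <= `|x|.
Proof.
apply: c0_norm_leP => n; rewrite restrE.
by case: (A n); [exact: c0_coord_le|rewrite normr0].
Qed.

Lemma restr_restr A B x : restr A (restr B x) = restr (predI A B) x.
Proof. by apply: c0_ext => n; rewrite !restrE /=; case: (A n); case: (B n). Qed.

Lemma eq_restr A B x : A =1 B -> restr A x = restr B x.
Proof. by move=> AB; apply: c0_ext => n; rewrite !restrE AB. Qed.

Lemma restrU A B x : (forall n, ~~ (A n && B n)) ->
  restr (predU A B) x = restr A x + restr B x.
Proof.
move=> AB; apply: c0_ext => n; rewrite valD !restrE /=.
by have := AB n; case: (A n); case: (B n); rewrite //= ?addr0 ?add0r.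
Qed.

Notation trunc N := (restr (fun n => n < N)%N).

Lemma trunc_cvg x (e : K) : 0 < e ->
  exists N, forall N', (N <= N')%N -> `|x - trunc N' x| <= e.
Proof.
move=> e0; have /null_seqP/cvgrPdist_lt/(_ _ e0)[N _ NP] := valP x.
exists N => N' NN'; apply: c0_norm_leP => n.
rewrite valB restrE; case: ltnP => [_|N'n].
  by rewrite subrr normr0 ltW.
have /NP : (N <= n)%N by exact: leq_trans N'n.
by rewrite sub0r subr0 normrN => /ltW.
Qed.

Lemma fin_subproof N (f : nat -> K) : (fun n => if (n < N)%N then f n else 0 : K^o) \in (@null_seq K).
Proof.
apply/null_seqP/cvgrPdist_lt => e e0; exists N => // n /= Nn.
by rewrite ltnNge Nn/= subrr normr0.
Qed.

Definition finseq N (f : nat -> K) : c0 K := exist (fun s : nat -> K^o => s \in @null_seq K) _ (fin_subproof N f).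

Lemma finseqE N f n : val (finseq N f) n = if (n < N)%N then f n else 0.
Proof. by []. Qed.

Lemma finseq_norm N f (M : K) : 0 <= M -> (forall n, `|f n| <= M) -> `|finseq N f| <= M.
Proof.
move=> M0 fM; apply: c0_norm_leP => n; rewrite finseqE.
by case: ifP => _; rewrite ?normr0.
Qed.

Definition unit_seq m : c0 K := finseq m.+1 (fun n => (n == m)%:R).

Lemma unit_seqE m n : val (unit_seq m) n = (n == m)%:R.
Proof. by rewrite finseqE ltnS; case: eqP => [->|_]; rewrite ?leqnn// if_same. Qed.

Lemma finseq_sum N f : finseq N f = \sum_(i < N) f i *: unit_seq i.
Proof.
apply: c0_ext => n; rewrite finseqE val_sum.
under eq_bigr do rewrite valZ unit_seqE.
case: ltnP => nN.
  rewrite (bigD1 (Ordinal nN))//= eqxx mulr1 big1 ?addr0// => i iN.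
  rewrite (_ : n == i = false) ?mulr0//; apply/negbTE; apply: contraNneq iN => ni.
  by apply/eqP/val_inj.
rewrite big1// => i _; rewrite gtn_eqF ?mulr0//.
exact: leq_trans nN.
Qed.

Lemma trunc_sum N x : trunc N x = \sum_(i < N) val x i *: unit_seq i.
Proof. by rewrite -finseq_sum; apply: c0_ext => n; rewrite restrE finseqE. Qed.

End NullSequenceBlocks.

Notation trunc N := (restr (fun n => n < N)%N).

Lemma form_bound_of_ball (K : numFieldType) (X Y : normedModType K)
    (f : {bilinear X -> Y -> K^o}) (M : K) :
  (forall x y, `|x| <= 1 -> `|y| <= 1 -> `|f x y| <= M) -> form_bound f M.
Proof.
move=> fM x y.
have [->|x0] := eqVneq x 0; first by rewrite linear0l !normr0 mul0r mulr0.
have [->|y0] := eqVneq y 0; first by rewrite linear0r !normr0 !mulr0.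
have unit (V : normedModType K) (v : V) : v != 0 -> `| `|v|^-1 *: v| <= 1.
  by move=> v0; rewrite normrZ normfV normr_id mulVf// normr_eq0.
have := fM _ _ (unit _ _ x0) (unit _ _ y0).
rewrite linearZl_LR linearZr_LR /= !normrM !normfV !normr_id mulrA -invfM.
rewrite mulrC ler_pdivrMr ?mulr_gt0 ?normr_gt0//.
Qed.

Section ColumnBlocks.
Context (K : numFieldType) (rcK : real_or_complex K).

(** Independent choices in three sets whose sums obey a common bound: the suprema
    obey it too, because each one can be taken while the other two are fixed. *)
Lemma sup3 (A1 A2 A3 : set K) (B : K) :
  A1 !=set0 -> A2 !=set0 -> A3 !=set0 ->
  (forall a, A1 a -> 0 <= a) -> (forall a, A2 a -> 0 <= a) -> (forall a, A3 a -> 0 <= a) ->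
  (forall a1 a2 a3, A1 a1 -> A2 a2 -> A3 a3 -> a1 + a2 + a3 <= B) ->
  exists b1 b2 b3, [/\ ubound A1 b1, ubound A2 b2, ubound A3 b3 & b1 + b2 + b3 <= B].
Proof.
move=> [x1 Ax1] [x2 Ax2] [x3 Ax3] p1 p2 p3 sumB.
have lub (A : set K) x b : A x -> (forall a, A a -> 0 <= a) -> ubound A b ->
    exists s, supremums A s.
  by move=> Ax pA Ab; apply: (scalar_lub rcK) => //; [exists x|exists b].
have [|b1 [b1u b1l]] := @lub A1 x1 (B - x2 - x3) Ax1 p1.
  by move=> a Aa; rewrite -addrA -opprD lerBrDr addrA; exact: sumB.
have b1P a2 a3 : A2 a2 -> A3 a3 -> b1 + a2 + a3 <= B.
  move=> A2a A3a; rewrite -addrA -lerBrDr; apply: b1l => a Aa.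
  by rewrite lerBrDr addrA; exact: sumB.
have [|b2 [b2u b2l]] := @lub A2 x2 (B - b1 - x3) Ax2 p2.
  by move=> a Aa; rewrite -addrA -opprD lerBrDr addrCA addrA; exact: b1P.
have b2P a3 : A3 a3 -> b1 + b2 + a3 <= B.
  move=> A3a; rewrite addrAC -lerBrDl; apply: b2l => a Aa.
  by rewrite lerBrDl addrAC; exact: b1P.
have [|b3 [b3u b3l]] := @lub A3 x3 (B - (b1 + b2)) Ax3 p3.
  by move=> a Aa; rewrite lerBrDl; exact: b2P.
exists b1, b2, b3; split=> //; rewrite -lerBrDl; apply: b3l => a Aa.
by rewrite lerBrDl; exact: b2P.
Qed.

(** The functional obtained by fixing the second variable of a form is an element
    of the dual l1 of c0; the signs of its coordinates compute its l1 norm. *)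
Lemma l1_norm_le (f : {bilinear c0 K -> c0 K -> K^o}) (M : K) N y :
  form_bound f M -> `|y| <= 1 -> 0 <= M -> \sum_(i < N) `|f (unit_seq K i) y| <= M.
Proof.
move=> fM y1 M0.
pose w (i : nat) : K := `|f (unit_seq K i) y| / f (unit_seq K i) y.
have w1 i : `|w i| <= 1.
  rewrite /w normrM normfV normr_id.
  by have [->|] := eqVneq `|f (unit_seq K i) y| 0; [rewrite mul0r|move=> ?; rewrite divff].
have E : \sum_(i < N) `|f (unit_seq K i) y| = f (finseq N w) y.
  rewrite finseq_sum linear_sumlz; apply: eq_bigr => i _.
  rewrite linearZl_LR /w /=.
  have [->|f0] := eqVneq (f (unit_seq K i) y) 0; first by rewrite normr0 scaler0.
  exact: (esym (divfK f0 _)).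
rewrite -[leLHS]ger0_norm ?sumr_ge0// E.
apply: le_trans (fM _ _) _; rewrite -[leRHS]mulr1 ler_wpM2l//.
by rewrite mulr_ile1// finseq_norm.
Qed.

Lemma sum_sign_norm (A1 A2 A3 : pred nat) (v1 v2 v3 : c0 K) :
  (forall n, ~~ (A1 n && A2 n)) -> (forall n, ~~ (A2 n && A3 n)) ->
  (forall n, ~~ (A1 n && A3 n)) ->
  `|v1| <= 1 -> `|v2| <= 1 -> `|v3| <= 1 ->
  `|restr A1 v1 + restr A2 v2 + restr A3 v3| <= 1.
Proof.
move=> A12 A23 A13 n1 n2 n3; apply: c0_norm_leP => n.
have c (v : c0 K) : `|v| <= 1 -> `|val v n| <= 1 by exact: le_trans (c0_coord_le v n).
rewrite !valD !restrE; move: (A12 n) (A23 n) (A13 n).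
by case: (A1 n); case: (A2 n); case: (A3 n); rewrite //= ?addr0 ?add0r ?normr0 ?c.
Qed.

(** Every choice of signs for three vectors with disjoint supports leaves a vector
    of norm at most 1 in the second variable, hence an l1 vector of norm at most M
    in the first. The averaging inequality, applied to each row index, compares
    these four l1 norms with the three that are to be added. The condition that
    the form only sees N rows keeps the sums over rows finite. *)
Lemma three_column_blocks_le (f : {bilinear c0 K -> c0 K -> K^o}) (M : K) N
    (A1 A2 A3 : pred nat) (u1 u2 u3 v1 v2 v3 : c0 K) :
  0 <= M -> form_bound f M -> (forall x y, f x y = f (trunc N x) y) ->
  (forall n, ~~ (A1 n && A2 n)) -> (forall n, ~~ (A2 n && A3 n)) ->
  (forall n, ~~ (A1 n && A3 n)) ->
  `|u1| <= 1 -> `|u2| <= 1 -> `|u3| <= 1 ->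
  `|v1| <= 1 -> `|v2| <= 1 -> `|v3| <= 1 ->
  `|f u1 (restr A1 v1)| + `|f u2 (restr A2 v2)| + `|f u3 (restr A3 v3)| <= 2 * M.
Proof.
move=> M0 fM fN A12 A23 A13 u1P u2P u3P v1P v2P v3P.
set g1 := restr A1 v1; set g2 := restr A2 v2; set g3 := restr A3 v3.
have rows u g : `|u| <= 1 -> `|f u g| <= \sum_(i < N) `|f (unit_seq K i) g|.
  move=> u1'; rewrite fN trunc_sum linear_sumlz.
  apply: le_trans (ler_norm_sum _ _ _) _; apply: ler_sum => i _.
  rewrite linearZl_LR normrM -[leRHS]mul1r ler_wpM2r//.
  exact: le_trans (c0_coord_le _ _) u1'.
apply: le_trans (lerD (lerD (rows _ _ u1P) (rows _ _ u2P)) (rows _ _ u3P)) _.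
have restrN A (v : c0 K) : - restr A v = restr A (- v).
  by apply: c0_ext => n; rewrite !(valN, restrE); case: (A n); rewrite ?oppr0.
have sgn w1 w2 w3 : `|w1| <= 1 -> `|w2| <= 1 -> `|w3| <= 1 ->
    \sum_(i < N) `|f (unit_seq K i) (restr A1 w1 + restr A2 w2 + restr A3 w3)| <= M.
  by move=> *; apply: l1_norm_le => //; exact: sum_sign_norm.
rewrite -!big_split/= -(ler_pM2l (ltr0n K 2)) mulr_sumr.
apply: le_trans (ler_sum _ (fun i _ => sign_average3 rcK _ _ _)) _.
rewrite !big_split/=.
have -> : 2 * (2 * M) = M + M + M + M by ring.
apply: lerD; [apply: lerD; [apply: lerD|]|].
- by under eq_bigr do rewrite -!linearDr; exact: sgn.
- by under eq_bigr do rewrite -linearNr -!linearDr restrN; apply: sgn; rewrite ?normrN.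
- by under eq_bigr do rewrite -linearNr -!linearDr restrN; apply: sgn; rewrite ?normrN.
- by under eq_bigr do rewrite -linearNr -!linearDr restrN; apply: sgn; rewrite ?normrN.
Qed.

Lemma restr_form (f : {bilinear c0 K -> c0 K -> K^o}) (A B : pred nat) :
  exists g : {bilinear c0 K -> c0 K -> K^o}, forall x y, g x y = f (restr A x) (restr B y).
Proof.
apply: (@bilinear_of K _ _ (fun x y => f (restr A x) (restr B y))).
by split=> [y|x] a u v /=; rewrite restrP ?linearPl ?linearPr.
Qed.

Lemma restr_predT (x : c0 K) : restr predT x = x.
Proof. by apply: c0_ext => n; rewrite restrE. Qed.

Lemma three_column_blocks (f : {bilinear c0 K -> c0 K -> K^o}) (M : K) N
    (A1 A2 A3 : pred nat) :
  0 <= M -> form_bound f M -> (forall x y, f x y = f (trunc N x) y) ->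
  (forall n, ~~ (A1 n && A2 n)) -> (forall n, ~~ (A2 n && A3 n)) ->
  (forall n, ~~ (A1 n && A3 n)) ->
  exists b1 b2 b3 : K, [/\ form_bound (fun x y => f x (restr A1 y)) b1,
    form_bound (fun x y => f x (restr A2 y)) b2,
    form_bound (fun x y => f x (restr A3 y)) b3 & b1 + b2 + b3 <= 2 * M].
Proof.
move=> M0 fM fN A12 A23 A13.
pose S (A : pred nat) : set K :=
  [set a | exists x y, [/\ `|x| <= 1, `|y| <= 1 & a = `|f x (restr A y)|]].
have S0 A : S A !=set0.
  by exists `|f 0 (restr A 0)|, 0, 0; rewrite !normr0.
have Sge0 A a : S A a -> 0 <= a by move=> [x [y [_ _ ->]]].
have [|b1 [b2 [b3 [b1P b2P b3P bM]]]] := @sup3 (S A1) (S A2) (S A3) (2 * M)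
    (S0 _) (S0 _) (S0 _) (Sge0 _) (Sge0 _) (Sge0 _).
  move=> a1 a2 a3 [u1 [v1 [u1P v1P ->]]] [u2 [v2 [u2P v2P ->]]] [u3 [v3 [u3P v3P ->]]].
  exact: (three_column_blocks_le M0 fM fN).
have SP A b : ubound (S A) b -> form_bound (fun x y => f x (restr A y)) b.
  move=> Sb; have [g gE] := restr_form f predT A.
  have gb : form_bound g b.
    by apply: form_bound_of_ball => x y x1 y1; apply: Sb; exists x, y; rewrite gE restr_predT.
  by move=> x y; have := gb x y; rewrite gE restr_predT.
by exists b1, b2, b3; split=> //; exact: SP.
Qed.

End ColumnBlocks.

Section ColumnBlocksPower.
Context (K : numFieldType) (rcK : real_or_complex K).

Lemma form_bound_ge0 (f : c0 K -> c0 K -> K^o) (b : K) : form_bound f b -> 0 <= b.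
Proof.
move=> fb; have u1 : `|unit_seq K 0| = 1.
  apply/eqP; rewrite eq_le; apply/andP; split.
    by apply: finseq_norm => // n; case: eqP; rewrite ?normr1 ?normr0.
  by have := c0_coord_le (unit_seq K 0) 0; rewrite unit_seqE eqxx normr1.
by have := fb (unit_seq K 0) (unit_seq K 0); rewrite u1 !mulr1; exact: le_trans.
Qed.

(** Iterating the case of three blocks: the norms of 3 ^ s disjoint column
    blocks of a form add up to at most 2 ^ s, which is o(3 ^ s). *)
Lemma column_blocks (s : nat) : forall (f : {bilinear c0 K -> c0 K -> K^o})
    (M : K) (N : nat) (A : nat -> pred nat),
  0 <= M -> form_bound f M -> (forall x y, f x y = f (trunc N x) y) ->
  (forall k l n, A k n -> A l n -> k = l) ->
  exists b : nat -> K,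
    (forall k, (k < 3 ^ s)%N -> form_bound (fun x y => f x (restr (A k) y)) (b k)) /\
    \sum_(k < 3 ^ s) b k <= 2 ^+ s * M.
Proof.
elim: s => [|s IH] f M N A M0 fM fN disj.
  exists (fun=> M); split=> [k _ x y|]; last by rewrite expn0 big_ord1 mul1r.
  apply: le_trans (fM _ _) _; rewrite !ler_wpM2l//; exact: restr_norm.
set m := (3 ^ s)%N in IH *.
pose J t : pred nat := fun n => has (fun k => A k n) (iota (t * m) m).
have Jdisj t t' : t != t' -> forall n, ~~ (J t n && J t' n).
  move=> tt' n; apply/negP => /andP[/hasP[k + Ak] /hasP[l + Al]].
  rewrite !mem_iota (disj _ _ _ Ak Al) => /andP[l1 l2] /andP[l3 l4].
  move: tt'; rewrite neq_ltn => /orP[] lt_t.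
    have := leq_mul lt_t (leqnn m); rewrite mulSn addnC => /(leq_trans l2)/leq_trans/(_ l3).
    by rewrite ltnn.
  have := leq_mul lt_t (leqnn m); rewrite mulSn addnC => /(leq_trans l4)/leq_trans/(_ l1).
  by rewrite ltnn.
have JA t k : (k < m)%N -> forall x, restr (J t) (restr (A (t * m + k)%N) x) = restr (A (t * m + k)%N) x.
  move=> km x; rewrite restr_restr; apply: eq_restr => n /=.
  have [An|_] := boolP (A _ n); last by rewrite andbF.
  rewrite andbT; apply/hasP; exists (t * m + k)%N => //.
  by rewrite mem_iota leq_addr ltn_add2l.
have [b0 [b1 [b2 [b0P b1P b2P bM]]]] := three_column_blocks rcK M0 fM fN
  (Jdisj 0%N 1%N isT) (Jdisj 1%N 2%N isT) (Jdisj 0%N 2%N isT).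
have part t b : form_bound (fun x y => f x (restr (J t) y)) b ->
    exists c : nat -> K,
      (forall k, (k < m)%N -> form_bound (fun x y => f x (restr (A (t * m + k)%N) y)) (c k)) /\
      \sum_(k < m) c k <= 2 ^+ s * b.
  move=> fb; have [g gE] := restr_form f predT (J t).
  have gE' x y : g x y = f x (restr (J t) y) by rewrite gE restr_predT.
  have gb : form_bound g b by move=> x y; rewrite gE'.
  have gN x y : g x y = g (trunc N x) y by rewrite !gE' fN.
  have [|c [cP cS]] := IH g b N (fun k => A (t * m + k)%N) (form_bound_ge0 gb) gb gN.
    by move=> k l n Ak Al; apply/eqP; rewrite -(eqn_add2l (t * m)); apply/eqP; exact: disj Ak Al.
  exists c; split=> // k km x y.
  by have := cP k km x y; rewrite gE' JA.
have [c0' [c0P c0S]] := part _ _ b0P.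
have [c1 [c1P c1S]] := part _ _ b1P.
have [c2 [c2P c2S]] := part _ _ b2P.
exists (fun k => if (k < m)%N then c0' k else
          if (k < m + m)%N then c1 (k - m)%N else c2 (k - (m + m))%N).
(* The blocks of J t, for t < 3, are those with indices from t * m on. *)
have m3 : (3 ^ s.+1 = m + (m + m))%N by rewrite expnS mulSn mulSn mul1n.
split.
  move=> k; rewrite m3 => km3; case: ltnP => [km|mk].
    exact: c0P.
  case: ltnP => [kmm|mmk].
    rewrite -[k in restr (A k)](subnKC mk) -{1}[m]mul1n; apply: c1P.
    by rewrite ltn_subLR.
  rewrite -[k in restr (A k)](subnKC mmk).
  have -> : (m + m = 2 * m)%N by rewrite mul2n addnn.
  apply: c2P; rewrite ltn_subLR ?mul2n -?addnn//.
  by rewrite -addnA.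
rewrite m3 !big_split_ord/=.
apply: le_trans (_ : 2 ^+ s * (b0 + b1 + b2) <= _); last first.
  by rewrite exprSr -mulrA ler_wpM2l// exprn_ge0.
rewrite !mulrDr -addrA; apply: lerD; [|apply: lerD].
- by apply: le_trans c0S; rewrite le_eqVlt; apply/orP; left; apply/eqP; apply: eq_bigr => i _; rewrite ltn_ord.
- apply: le_trans c1S; rewrite le_eqVlt; apply/orP; left; apply/eqP; apply: eq_bigr => i _.
  by rewrite ltnNge leq_addr/= ltn_add2l ltn_ord addKn.
- apply: le_trans c2S; rewrite le_eqVlt; apply/orP; left; apply/eqP; apply: eq_bigr => i _.
  rewrite ltnNge leq_addr/= ltn_add2l ltnNge leq_addr/=.
  by rewrite addnA addKn.
Qed.

End ColumnBlocksPower.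

(** * Sums of block vectors in the tensor square *)

Section BlockSums.
Context (K : numFieldType) (rcK : real_or_complex K).
Context (E : completeNormedModType K) (t : {bilinear c0 K -> c0 K -> E}).
Context (tP : projective_tensor_product t).

Local Notation ev f s := (\sum_(p <- s) f p.1 p.2).
Local Notation tau s := (ev t s).

Definition trunc_seq N (s : seq (c0 K * c0 K)) := [seq (trunc N p.1, trunc N p.2) | p <- s].

Lemma trunc_seq_cvg (s : seq (c0 K * c0 K)) (e : K) : 0 < e ->
  exists N, forall N', (N <= N')%N -> `|tau s - tau (trunc_seq N' s)| <= e.
Proof.
elim: s e => [|[x y] s IH] e e0; first by exists 0%N => N' _; rewrite !big_nil subrr normr0 ltW.
have e2 : 0 < e / 2 by rewrite divr_gt0.
have [N1 N1P] := IH _ e2.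
have y1 : 0 < `|y| + 1 by rewrite ltr_wpDl.
have x1 : 0 < `|x| + 1 by rewrite ltr_wpDl.
have [N2 N2P] := trunc_cvg x (divr_gt0 (divr_gt0 e2 (ltr0Sn K 1)) y1).
have [N3 N3P] := trunc_cvg y (divr_gt0 (divr_gt0 e2 (ltr0Sn K 1)) x1).
exists (maxn N1 (maxn N2 N3)) => N'; rewrite !geq_max => /and3P[l1 l2 l3].
rewrite /= !big_cons /= opprD addrACA (splitr e).
apply: le_trans (ler_normD _ _) (lerD _ (N1P _ l1)).
have -> : t x y - t (trunc N' x) (trunc N' y) =
    t (x - trunc N' x) y + t (trunc N' x) (y - trunc N' y).
  by rewrite linearBl linearBr addrA subrK.
apply: le_trans (ler_normD _ _) _; rewrite (splitr (e / 2)); apply: lerD.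
  apply: le_trans (tensor_map_le tP _ _) _; apply: le_trans (ler_wpM2r _ (N2P _ l2)) _ => //.
  by rewrite mulrAC ler_pdivrMr// ler_wpM2l ?lerDl//; rewrite ltW// divr_gt0.
apply: le_trans (tensor_map_le tP _ _) _; rewrite mulrC.
apply: le_trans (ler_pM _ _ (N3P _ l3) (restr_norm _ _)) _ => //.
by rewrite mulrAC ler_pdivrMr// ler_wpM2l ?lerDl//; rewrite ltW// divr_gt0.
Qed.

Lemma trunc_trunc N N' (x : c0 K) : (N <= N')%N -> trunc N' (trunc N x) = trunc N x.
Proof.
move=> NN'; rewrite restr_restr; apply: eq_restr => n /=.
by case: (ltnP n N) => [nN|]; rewrite ?andbF// (leq_trans nN).
Qed.

Lemma finite_approx (z : E) (e : K) N0 : 0 < e ->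
  exists N s, [/\ (N0 <= N)%N, trunc_seq N s = s & `|z - tau s| <= e].
Proof.
move=> e0; have e2 : 0 < e / 2 by rewrite divr_gt0.
have [s /ltW zs] := tensor_approx tP z e2.
have [N NP] := trunc_seq_cvg s e2.
exists (maxn N N0), (trunc_seq (maxn N N0) s); split; first exact: leq_maxr.
  by rewrite /trunc_seq -map_comp; apply: eq_map => p /=; rewrite !trunc_trunc.
rewrite (splitr e); apply: le_trans (ler_distD (tau s) _ _) (lerD zs _).
by apply: NP; exact: leq_maxl.
Qed.

(** A form restricted to a finite square is a combination, with coefficients of
    modulus at most 1, of products of coordinates; so finitely many coordinates
    control all forms of norm at most 1 there. *)
Lemma corner_sum (f : {bilinear c0 K -> c0 K -> K^o}) N s : form_bound f 1 ->
  `|ev (fun x y => f (trunc N x) (trunc N y)) s| <=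
    \sum_(i < N) \sum_(j < N) `|ev (fun x y : c0 K => val x i * val y j) s|.
Proof.
move=> f1.
have -> : ev (fun x y => f (trunc N x) (trunc N y)) s =
    \sum_(i < N) \sum_(j < N) f (unit_seq K i) (unit_seq K j) *
      ev (fun x y : c0 K => val x i * val y j) s.
  transitivity (\sum_(p <- s) \sum_(i < N) \sum_(j < N)
     f (unit_seq K i) (unit_seq K j) * (val p.1 i * val p.2 j)).
    apply: eq_bigr => p _; rewrite (trunc_sum _ p.1) linear_sumlz; apply: eq_bigr => i _.
    rewrite (trunc_sum _ p.2) linear_sumr; apply: eq_bigr => j _.
    by rewrite linearZl_LR linearZr_LR scalerA [RHS]mulrC.
  rewrite exchange_big; apply: eq_bigr => i _; rewrite exchange_big.
  by apply: eq_bigr => j _; rewrite mulr_sumr.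
apply: le_trans (ler_norm_sum _ _ _) _; apply: ler_sum => i _.
apply: le_trans (ler_norm_sum _ _ _) _; apply: ler_sum => j _.
rewrite normrM -[leRHS]mul1r ler_wpM2r//.
apply: le_trans (f1 _ _) _; rewrite mul1r mulr_ile1//;
  by apply: finseq_norm => // n; case: eqP; rewrite ?normr1 ?normr0.
Qed.

(** Rows and columns play symmetric parts: the block of columns I_k is handled by
    the form itself, the block of rows I_k by the form with exchanged variables.
    Truncating at the last cutoff leaves finitely many rows in both cases. *)
Lemma block_sum_le (s : nat) (N : nat -> nat) (r : nat -> seq (c0 K * c0 K)) (B d : K) :
  (forall k, (N k <= N k.+1)%N) ->
  (forall k, trunc_seq (N k.+1) (r k) = r k) ->
  (forall k, `|tau (r k)| <= B) ->
  (forall k (f : {bilinear c0 K -> c0 K -> K^o}), form_bound f 1 ->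
     `|ev (fun x y => f (trunc (N k) x) (trunc (N k) y)) (r k)| <= d) ->
  `|\sum_(k < 3 ^ s) tau (r k)| <= (3 ^ s)%:R * d + 2 ^+ s * B + 2 ^+ s * B.
Proof.
move=> Nmono rN rB rd; set n := (3 ^ s)%N.
have Nle : {homo N : i j / (i <= j)%N} by apply: homo_leq => //; exact: leq_trans.
pose A k : pred nat := fun i => (N k <= i < N k.+1)%N.
have Adisj k l i : A k i -> A l i -> k = l.
  move=> /andP[k1 k2] /andP[l1 l2]; apply/eqP; rewrite eqn_leq; apply/andP; split.
    rewrite leqNgt; apply/negP => /Nle lk.
    by have := leq_trans l2 (leq_trans lk k1); rewrite ltnn.
  rewrite leqNgt; apply/negP => /Nle lk.
  by have := leq_trans k2 (leq_trans lk l1); rewrite ltnn.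
have evS (V : lmodType K) (g : c0 K -> c0 K -> V) :
    \sum_(k < n) ev g (r k) = ev g (flatten [seq r k | k <- index_iota 0 n]).
  by rewrite big_flatten big_map big_mkord.
rewrite evS; apply: (tensor_norm_le tP) => f f1; rewrite -evS.
have B0 : 0 <= B by exact: le_trans (rB 0%N).
have [f1' f1'E] : exists g : {bilinear c0 K -> c0 K -> K^o},
    forall x y, g x y = f (trunc (N n) x) y.
  have [g gE] := restr_form f (fun i => i < N n)%N predT.
  by exists g => x y; rewrite gE restr_predT.
have [f2' f2'E] : exists g : {bilinear c0 K -> c0 K -> K^o},
    forall x y, g x y = f y (trunc (N n) x).
  apply: (@bilinear_of K _ _ (fun x y => f y (trunc (N n) x))).
  by split=> [y|x] a u v /=; rewrite ?restrP ?linearPl ?linearPr.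
have f1'1 : form_bound f1' 1.
  move=> x y; rewrite f1'E; apply: le_trans (f1 _ _) _.
  by rewrite !mul1r ler_wpM2r// restr_norm.
have f2'1 : form_bound f2' 1.
  move=> x y; rewrite f2'E; apply: le_trans (f1 _ _) _.
  by rewrite !mul1r mulrC ler_wpM2r// restr_norm.
have [b [bP bS]] := column_blocks rcK s ler01 f1'1
  (fun x y => etrans (f1'E x y) (esym (etrans (f1'E _ _) (congr1 (f^~ y) (trunc_trunc x (leqnn _))))))
  Adisj.
have [b' [b'P b'S]] := column_blocks rcK s ler01 f2'1
  (fun x y => etrans (f2'E x y) (esym (etrans (f2'E _ _) (congr1 (f y) (trunc_trunc x (leqnn _))))))
  Adisj.
rewrite !mulr1 in bS b'S.
apply: le_trans (ler_norm_sum _ _ _) _.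
apply: (@le_trans _ _ (\sum_(k < n) (d + b k * B + b' k * B))); last first.
  rewrite !big_split/= sumr_const card_ord mulr_natl -!mulr_suml.
  by rewrite !lerD// ler_wpM2r.
apply: ler_sum => k _.
have [g1 g1E] := restr_form f (fun i => i < N k)%N (A k).
have [g2 g2E] := restr_form f (A k) (fun i => i < N k.+1)%N.
have truncS (x : c0 K) : trunc (N k.+1) x = trunc (N k) x + restr (A k) x.
  rewrite -restrU; last by move=> i; rewrite /A; case: ltnP.
  apply: eq_restr => i; rewrite /= /A; case: (ltnP i (N k)) => //= iN.
  exact: leq_trans iN (Nmono k).
have -> : ev f (r k) = ev (fun x y => f (trunc (N k) x) (trunc (N k) y)) (r k)
    + ev g1 (r k) + ev g2 (r k).
  rewrite -{1}(rN k) /trunc_seq big_map -!big_split/=; apply: eq_bigr => p _.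
  by rewrite g1E g2E -linearDr -truncS -linearDl -truncS.
have g1b : form_bound g1 (b k).
  move=> x y; rewrite g1E.
  have := bP k (ltn_ord k) (trunc (N k) x) y; rewrite f1'E trunc_trunc; last exact: Nle (ltnW _).
  move=> /le_trans; apply; rewrite ler_wpM2l ?ler_wpM2r ?restr_norm//.
  exact: form_bound_ge0 (bP k (ltn_ord k)).
have g2b : form_bound g2 (b' k).
  move=> x y; rewrite g2E.
  have := b'P k (ltn_ord k) (trunc (N k.+1) y) x; rewrite f2'E trunc_trunc; last exact: Nle.
  move=> /le_trans; apply; rewrite mulrC (mulrC `|x|) mulrC ler_wpM2l ?ler_wpM2r ?restr_norm//.
  exact: form_bound_ge0 (b'P k (ltn_ord k)).
have bk := form_bound_ge0 g1b; have b'k := form_bound_ge0 g2b.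
apply: le_trans (ler_normD _ _) _; apply: lerD.
  apply: le_trans (ler_normD _ _) _; apply: lerD; first exact: rd.
  by apply: le_trans (form_tensor_le tP _ bk g1b) _; rewrite ler_wpM2l.
by apply: le_trans (form_tensor_le tP _ b'k g2b) _; rewrite ler_wpM2l.
Qed.

End BlockSums.

(** * Weakly null sequences and growth of sums *)

Section WeaklyNull.
Context (K : numFieldType) (rcK : real_or_complex K).

(** A quantitative form of weakly unconditionally Cauchy series. *)
Definition signed_sums_bounded (V : normedModType K) (z : nat -> V) (C : K) :=
  forall m0 R (w : nat -> K), (forall i, `|w i| <= 1) ->
    `|\sum_(i < R) w i *: z (m0 + i)%N| <= C.

(** The moduli of the values of a bounded functional have bounded sums, so among
    many consecutive indices the average of finitely many functionals is small. *)
Lemma signed_sums_null (V : normedModType K) (z : nat -> V) (C : K) (J : finType)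
    (psi : J -> {linear V -> K^o}) (m0 : nat) (d : K) :
  signed_sums_bounded z C -> (forall j v, `|psi j v| <= `|v|) -> 0 < d ->
  exists2 m, (m0 <= m)%N & \sum_j `|psi j (z m)| <= d.
Proof.
move=> zC psi1 d0.
have C0 : 0 <= C.
  by apply: le_trans (zC 0%N 0%N (fun=> 0) _) => // i; rewrite normr0.
apply: contrapT => H.
have large m : (m0 <= m)%N -> d < \sum_j `|psi j (z m)|.
  have Sr : \sum_j `|psi j (z m)| \is Num.real by apply/ger0_real/sumr_ge0.
  move=> mm; rewrite real_ltNge ?(gtr0_real d0)//.
  by apply/negP => le_d; apply: H; exists m.
have q0 : 0 <= #|J|%:R * C / d by rewrite !mulr_ge0// invr_ge0 ltW.
have [R RP] := scalar_archimedean rcK q0.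
have : R%:R * d <= #|J|%:R * C.
  apply: (@le_trans _ _ (\sum_(i < R) \sum_j `|psi j (z (m0 + i)%N)|)).
    rewrite mulr_natl -[R in _ *+ R]card_ord -sumr_const; apply: ler_sum => i _.
    by apply: ltW; apply: large; exact: leq_addr.
  rewrite exchange_big mulr_natl -sumr_const; apply: ler_sum => j _.
  pose w i : K := `|psi j (z (m0 + i)%N)| / psi j (z (m0 + i)%N).
  have w1 i : `|w i| <= 1.
    rewrite /w normrM normfV normr_id.
    by have [->|] := eqVneq `|psi j (z (m0 + i)%N)| 0; [rewrite mul0r|move=> ?; rewrite divff].
  have E : \sum_(i < R) `|psi j (z (m0 + i)%N)| = psi j (\sum_(i < R) w i *: z (m0 + i)%N).
    rewrite linear_sum; apply: eq_bigr => i _; rewrite linearZ /w.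
    have [->|p0] := eqVneq (psi j (z (m0 + i)%N)) 0; first by rewrite normr0 [RHS]mulr0.
    exact: (esym (divfK p0 _)).
  rewrite -[leLHS]ger0_norm ?sumr_ge0// E.
  exact: le_trans (psi1 _ _) (zC _ _ _ w1).
rewrite -ler_pdivlMr// => /(lt_le_trans RP); by rewrite ltxx.
Qed.

Lemma unit_seq_sums : signed_sums_bounded (@unit_seq K) 1.
Proof.
move=> m0 R w w1; apply: c0_norm_leP => n; rewrite val_sum.
under eq_bigr do rewrite valZ unit_seqE.
have [/andP[mn nR]|out] := boolP (m0 <= n < m0 + R)%N.
  have iR : (n - m0 < R)%N by rewrite ltn_subLR.
  rewrite (bigD1 (Ordinal iR))//= subnKC// eqxx mulr1 big1 ?addr0// => i iN.
  rewrite (_ : n == (m0 + i)%N = false) ?mulr0//.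
  apply/negbTE; apply: contraNneq iN => ni; apply/eqP/val_inj => /=.
  by rewrite ni addKn.
rewrite big1 ?normr0// => i _; rewrite (_ : n == (m0 + i)%N = false) ?mulr0//.
apply/negbTE; apply: contraNneq out => ->.
by rewrite leq_addr ltn_add2l ltn_ord.
Qed.

Context (E : completeNormedModType K) (t : {bilinear c0 K -> c0 K -> E}).
Context (tP : projective_tensor_product t).

Local Notation ev f s := (\sum_(p <- s) f p.1 p.2).
Local Notation tau s := (ev t s).

(** One step of the gliding hump: beyond any index there is a vector of the
    sequence close to a finitely supported sum that is small on the square of
    side N, uniformly over all forms of norm at most 1. *)
Lemma weakly_null_block (z : nat -> E) (C d : K) (m0 N : nat) :
  signed_sums_bounded z C -> 0 < d ->
  exists m N' s, [/\ (m0 <= m)%N, (N <= N')%N, trunc_seq N' s = s,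
    `|z m - tau s| <= d &
    forall f : {bilinear c0 K -> c0 K -> K^o}, form_bound f 1 ->
      `|ev (fun x y => f (trunc N x) (trunc N y)) s| <= d].
Proof.
move=> zC d0.
have coord (i j : 'I_N) : exists psi : {linear E -> K^o},
    (forall x y, psi (t x y) = val x i * val y j) /\ (forall v, `|psi v| <= `|v|).
  have [g gE] : exists g : {bilinear c0 K -> c0 K -> K^o}, forall x y, g x y = val x i * val y j.
    apply: (@bilinear_of K _ _ (fun x y : c0 K => val x i * val y j : K^o)).
    split=> [y|x] a u v; cbv beta; rewrite valD valZ.
      by rewrite mulrDl -mulrA.
    by rewrite mulrDr mulrCA.
  have g1 : form_bound g 1 by move=> x y; rewrite gE mul1r normrM ler_pM// c0_coord_le.
  have [psi [psiE psi1]] := linear_extension (scalar_complete rcK) tP ler01 g1.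
  by exists psi; split=> [x y|v]; rewrite ?psiE ?gE// -[leRHS]mul1r.
pose psi (ij : 'I_N * 'I_N) := sval (cid (coord ij.1 ij.2)).
have psiP ij := svalP (cid (coord ij.1 ij.2)).
have d2 : 0 < d / 2 by rewrite divr_gt0.
have [m m0m mP] := signed_sums_null m0 zC (psi := psi) (fun j => (psiP j).2) d2.
pose Q : K := #|{: 'I_N * 'I_N}|%:R.
have Q1 : 0 < Q + 1 by rewrite ltr_wpDl.
have [N' [s [NN' sN' zs]]] := finite_approx tP (z m) N (divr_gt0 d2 Q1).
exists m, N', s; split=> //.
  apply: le_trans zs _; rewrite -mulrA ler_piMr ?(ltW d0)//.
  rewrite -invfM invf_le1 ?mulr_gt0//.
  by rewrite mulrDr mulr1 (@le_trans _ _ 2) ?ler1n// lerDr mulr_ge0.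
move=> f f1; apply: le_trans (corner_sum N s f1) _.
rewrite pair_bigA /=.
apply: (@le_trans _ _ (\sum_(ij : 'I_N * 'I_N) (`|psi ij (z m)| + d / 2 / (Q + 1)))).
  apply: ler_sum => ij _.
  have -> : ev (fun x y : c0 K => val x ij.1 * val y ij.2) s = psi ij (tau s).
    by rewrite linear_sum; apply: eq_bigr => p _; rewrite (psiP ij).1.
  rewrite -[tau s](subKr (z m)) linearB.
  apply: le_trans (ler_normB _ _) _; rewrite lerD2l.
  exact: le_trans ((psiP ij).2 _) zs.
rewrite big_split/= [leRHS]splitr lerD// sumr_const -[_ *+ _]mulr_natl -/Q mulrCA.
by rewrite ler_piMr ?(ltW d2)// ler_pdivrMr// mul1r lerDl.
Qed.

End WeaklyNull.

Section LowerEstimate.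
Context (K : numFieldType) (rcK : real_or_complex K).
Context (E F : completeNormedModType K).
Context (t2 : {bilinear c0 K -> c0 K -> E}) (t3 : {bilinear E -> c0 K -> F}).
Context (t2P : projective_tensor_product t2) (t3P : projective_tensor_product t3).

(** The norming form on E x c0 needs the functionals on all of E, not only on
    finite sums; this is where the extension of forms enters. All combinations
    of those functionals with coefficients of modulus at most 1 have norm at most
    1, so the tensors w k behave like the basis of l1, and
    tensoring them with distinct unit vectors keeps this growth while letting each
    term tend weakly to 0. *)
Lemma ell1_tensors (n : nat) : exists w : nat -> E,
  (forall k, `|w k| <= 1) /\
  forall m : nat -> nat, injective m -> n%:R <= `|\sum_(k < n) t3 (w k) (unit_seq K (m k))|.
Proof.
have [D [h [D0 h1 hh bessel0]]] := rademacher rcK n.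
have bessel u := le_trans (ler_wpDl (exprn_ge0 2 (normr_ge0 _)) (lexx _)) (bessel0 u).
pose H k : c0 K := finseq D (h k).
exists (fun k => t2 (H k) (H k)); split=> [k|m m_inj].
  apply: le_trans (tensor_map_le t2P _ _) _.
  by rewrite mulr_ile1// finseq_norm.
have D2 : D%:R ^+ 2 != 0 :> K by rewrite expf_neq0// pnatr_eq0 -lt0n.
have combo (theta : nat -> K) (B : K) : (forall k, `|theta k| <= B) ->
    exists g : {bilinear c0 K -> c0 K -> K^o}, form_bound g B /\
    forall x y, g x y = \sum_(k < n) theta k * (D%:R ^- 2 *
      ((\sum_(i < D) val x i * h k i) * (\sum_(i < D) val y i * h k i))).
  move=> thetaB.
  have [|g gE] := @bilinear_of K _ _ (fun x y : c0 K => \sum_(k < n) theta k * (D%:R ^- 2 *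
      ((\sum_(i < D) val x i * h k i) * (\sum_(i < D) val y i * h k i))) : K^o).
    have lin (a : K) (u v : c0 K) k : \sum_(i < D) val (a *: u + v) i * h k i =
        a * (\sum_(i < D) val u i * h k i) + \sum_(i < D) val v i * h k i.
      rewrite mulr_sumr -[RHS]big_split; apply: eq_bigr => i _.
      by rewrite valD valZ mulrDl mulrA.
    split=> [y|x] a u v; cbv beta;
      rewrite -[X in _ = X + _]/(a * _) mulr_sumr -[RHS]big_split;
      apply: eq_bigr => k _; rewrite lin.
      by rewrite mulrDl !mulrDr; congr (_ + _); rewrite -mulrA !(mulrCA _ a).
    by rewrite !mulrDr; congr (_ + _); rewrite !(mulrCA _ a).
  exists g; split=> // x y; rewrite gE.
  have := bessel_product bessel thetaB (c0_coord_le x) (c0_coord_le y).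
  under [X in _ -> `|X| <= _]eq_bigr do rewrite mulrCA.
  rewrite -mulr_sumr normrM normfV normrX normr_nat => H'.
  rewrite mulrC ler_pdivrMr ?exprn_gt0 ?ltr0n//.
  by rewrite -mulrA.
have coef (k : 'I_n) : exists psi : {linear E -> K^o}, (forall x y, psi (t2 x y) = D%:R ^- 2 *
      ((\sum_(i < D) val x i * h k i) * (\sum_(i < D) val y i * h k i))) /\
    forall z, `|psi z| <= `|z|.
  have [l|g [gb gE]] := combo (fun l => (l == k)%:R) 1.
    by case: eqP; rewrite ?normr1 ?normr0.
  have [psi [psiE psi1]] := linear_extension (scalar_complete rcK) t2P ler01 gb.
  exists psi; split=> [x y|z]; last by rewrite -[leRHS]mul1r.
  rewrite psiE gE (bigD1 k)//= eqxx mul1r [X in _ + X]big1 ?addr0// => l lk.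
  by rewrite (_ : (l == k :> nat) = false) ?mul0r//; apply/negbTE.
pose psi k := sval (cid (coef k)).
have psiE k := (svalP (cid (coef k))).1.
have psi1 k := (svalP (cid (coef k))).2.
have mix (theta : nat -> K) (B : K) : (forall k, `|theta k| <= B) ->
    forall z, `|\sum_(k < n) theta k * psi k z| <= B * `|z|.
  move=> thetaB; have B0 : 0 <= B := le_trans (normr_ge0 _) (thetaB 0%N).
  have [g [gb gE]] := combo _ _ thetaB.
  have [|Psi PsiE] := @linear_of K E (fun z => \sum_(k < n) theta k * psi k z : K^o).
    move=> a u v; rewrite -[X in _ = X + _]/(a * _) mulr_sumr -[RHS]big_split.
    apply: eq_bigr => k _.
    by rewrite linearP mulrDr; congr (_ + _); exact: mulrCA.
  move=> z; rewrite -PsiE.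
  apply: (linear_extension_bound t2P B0 (B := \sum_(k < n) `|theta k|) _ gb).
  - exact: sumr_ge0.
  - by move=> x y; rewrite PsiE gE; apply: eq_bigr => k _; rewrite psiE.
  - move=> v; rewrite PsiE mulr_suml; apply: le_trans (ler_norm_sum _ _ _) _.
    by apply: ler_sum => k _; rewrite normrM; apply: ler_wpM2l (psi1 k v).
(* The coordinates of x at the indices m k serve as the coefficients theta. *)
have [|g gE] := @bilinear_of K E (c0 K) (fun z x => \sum_(k < n) val x (m k) * psi k z : K^o).
  split=> [y|x] a u v; cbv beta;
    rewrite -[X in _ = X + _]/(a * _) mulr_sumr -[RHS]big_split;
    apply: eq_bigr => k _.
    by rewrite linearP mulrDr; congr (_ + _); exact: mulrCA.
  by rewrite valD valZ mulrDl -mulrA.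
have gb : form_bound g 1.
  move=> z x; rewrite gE mul1r mulrC.
  exact: (mix (fun k => val x (m k)) _ (fun k => c0_coord_le x (m k))).
have := form_tensor_le t3P [seq (t2 (H k) (H k), unit_seq K (m k)) | k : 'I_n <- index_enum 'I_n] ler01 gb.
rewrite !big_map /= mul1r; apply: le_trans.
rewrite (eq_bigr (fun=> 1)) ?sumr_const ?card_ord ?normr_nat// => k _.
rewrite gE; under eq_bigr do rewrite unit_seqE.
rewrite (bigD1 k)//= eqxx mul1r [X in _ + X]big1 ?addr0 => [|l lk].
  rewrite psiE; have -> : \sum_(i < D) val (H k) i * h k i = D%:R.
    by rewrite -(hh k (ltn_ord k)); apply: eq_bigr => i _; rewrite finseqE ltn_ord.
  by rewrite -expr2 mulVf.
rewrite (_ : (m l == m k) = false) ?mul0r//.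
by apply/negbTE; apply: contraNneq lk => /m_inj /val_inj ->.
Qed.

End LowerEstimate.

(** Bernoulli's inequality for 3 / 2, cleared of denominators. *)
Lemma nat_mul_exp2_le s : (s * 2 ^ s <= 2 * 3 ^ s)%N.
Proof.
have le23 k : (2 ^ k <= 3 ^ k)%N by elim: k => // k IH; rewrite !expnS leq_mul.
elim: s => // s IH; rewrite !expnS mulSn mulnCA addnC.
have -> : (2 * (3 * 3 ^ s) = 2 * (2 * 3 ^ s) + 2 * 3 ^ s)%N.
  by rewrite -mulnDr -[X in (_ + X)%N]mul1n -mulnDl.
by apply: leq_add; rewrite leq_mul2l ?IH ?le23.
Qed.

Lemma increasing_injective (m : nat -> nat) :
  (forall k, (m k < m k.+1)%N) -> injective m.
Proof.
move=> mS; have mono := homo_ltn ltn_trans mS.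
by move=> i j mij; case: (ltngtP i j) => // /mono; rewrite mij ltnn.
Qed.

(** * The triple product does not embed into the square *)

Section Main.
Context (K : numFieldType) (rcK : real_or_complex K).
Context (E F : completeNormedModType K).
Context (t2 : {bilinear c0 K -> c0 K -> E}) (t3 : {bilinear E -> c0 K -> F}).
Context (t2P : projective_tensor_product t2) (t3P : projective_tensor_product t3).

(** The indices m k are found one after the other by the gliding hump; the sum of
    the approximating block vectors is then estimated by [block_sum_le]. *)
Lemma image_upper_estimate (T : {linear F -> E}) (C d : K) (s : nat) (w : nat -> E) :
  0 <= C -> (forall x, `|T x| <= C * `|x|) -> 0 < d -> (forall k, `|w k| <= 1) ->
  exists2 m : nat -> nat, injective m &
    `|T (\sum_(k < 3 ^ s) t3 (w k) (unit_seq K (m k)))| <=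
    (3 ^ s)%:R * (d + d) + 2 ^+ s * (2 * (C + d)).
Proof.
move=> C0 TC d0 w1.
pose z k m := T (t3 (w k) (unit_seq K m)).
have zC k : signed_sums_bounded (z k) C.
  move=> m0 R a a1.
  have -> : \sum_(i < R) a i *: z k (m0 + i)%N =
      T (t3 (w k) (\sum_(i < R) a i *: unit_seq K (m0 + i)%N)).
    rewrite linear_sumr linear_sum; apply: eq_bigr => i _.
    by rewrite linearZr_LR linearZ.
  apply: le_trans (TC _) _; rewrite -[leRHS]mulr1 ler_wpM2l//.
  apply: le_trans (tensor_map_le t3P _ _) _; rewrite mulr_ile1//.
  exact: unit_seq_sums.
pose good (q : nat * (nat * nat)) (r : (nat * nat) * seq (c0 K * c0 K)) :=
  [/\ (q.2.1 <= r.1.1)%N, (q.2.2 <= r.1.2)%N, trunc_seq r.1.2 r.2 = r.2,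
    `|z q.1 r.1.1 - \sum_(p <- r.2) t2 p.1 p.2| <= d &
    forall f : {bilinear c0 K -> c0 K -> K^o}, form_bound f 1 ->
      `|\sum_(p <- r.2) f (trunc q.2.2 p.1) (trunc q.2.2 p.2)| <= d].
have /choice[next nextP] : forall q, exists r, good q r.
  move=> [k [m0 N]].
  have [m [N' [r [*]]]] := weakly_null_block rcK t2P m0 N (zC k) d0.
  by exists ((m, N'), r).
(* The state holds a lower bound for the next index and the current cutoff. *)
pose st := fix st k := if k is j.+1 then
    let r := next (j, st j) in (r.1.1.+1, r.1.2) else (0%N, 0%N).
pose r k := next (k, st k).
pose m k := (r k).1.1.
have rP k : good (k, st k) (r k) by exact: nextP.
have mlt k : (m k < m k.+1)%N by have [] := rP k.+1.
exists m; first exact: increasing_injective.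
rewrite linear_sum.
have -> : \sum_(k < 3 ^ s) T (t3 (w k) (unit_seq K (m k))) =
    \sum_(k < 3 ^ s) (z k (m k) - \sum_(p <- (r k).2) t2 p.1 p.2) +
    \sum_(k < 3 ^ s) \sum_(p <- (r k).2) t2 p.1 p.2.
  by rewrite -big_split/=; apply: eq_bigr => k _; rewrite subrK.
have zr k : `|z k (m k) - \sum_(p <- (r k).2) t2 p.1 p.2| <= d by have [] := rP k.
apply: le_trans (ler_normD _ _) _; rewrite mulrDr -addrA; apply: lerD.
  apply: le_trans (ler_norm_sum _ _ _) _.
  apply: le_trans (ler_sum _ (fun (k : 'I__) _ => zr k)) _.
  by rewrite sumr_const card_ord mulr_natl.
have -> : (3 ^ s)%:R * d + 2 ^+ s * (2 * (C + d)) =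
    (3 ^ s)%:R * d + 2 ^+ s * (C + d) + 2 ^+ s * (C + d) by ring.
apply: (block_sum_le rcK t2P s (N := fun k => (st k).2) (r := fun k => (r k).2)).
- by move=> k; have [] := rP k.
- by move=> k; have [] := rP k.
- move=> k; rewrite -[X in `|X|](subKr (z k (m k))).
  apply: le_trans (ler_normB _ _) (lerD _ (zr k)).
  have := zC k (m k) 1%N (fun=> 1); rewrite big_ord1 scale1r addn0; apply => _.
  by rewrite normr1.
- by move=> k; have [] := rP k.
Qed.

Lemma triple_not_in_double : ~ isomorphic_to_subspace F E.
Proof.
move=> [T [[C' TC'] [c c0 Tc]]].
pose C := `|C'|.
have TC x : `|T x| <= C * `|x|.
  have := le_trans (normr_ge0 _) (TC' x) => /ger0_norm; rewrite normrM normr_id => ->.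
  exact: TC'.
(* With this error, the part of the upper estimate that grows like 3 ^ s is a
   quarter of the lower one, which leaves room for the part in 2 ^ s. *)
pose d := c / 8.
have d0 : 0 < d by rewrite divr_gt0.
have q0 : 0 <= 8 * (C + d) / c.
  by rewrite mulr_ge0 ?invr_ge0 ?(ltW c0)// mulr_ge0// addr_ge0 ?(ltW d0) /C.
have [s sP] := scalar_archimedean rcK q0.
have [w [w1 wP]] := ell1_tensors rcK t2P t3P (3 ^ s).
have [m minj mP] := image_upper_estimate s (normr_ge0 C') TC d0 w1.
have H := le_trans (le_trans (ler_wpM2l (ltW c0) (wP _ minj)) (Tc _)) mP.
set n : K := (3 ^ s)%:R in H.
have n0 : 0 < n by rewrite /n ltr0n expn_gt0.
have cn0 : 0 < c * n by exact: mulr_gt0.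
have H3 : 3 * (c * n) <= 2 ^+ s * (8 * (C + d)).
  rewrite -(lerD2l (c * n)).
  have -> : c * n + 3 * (c * n) = 4 * (c * n) by ring.
  apply: le_trans (ler_wpM2l (ler0n K 4) H) _.
  rewrite le_eqVlt; apply/orP; left; apply/eqP.
  by rewrite /d -/C; field.
have H2 : 2 ^+ s * (8 * (C + d)) <= 2 * (c * n).
  rewrite ltr_pdivrMr// in sP.
  apply: le_trans (ler_wpM2l (exprn_ge0 s (ler0n K 2)) (ltW sP)) _.
  have -> : 2 ^+ s * (s%:R * c) = c * (s * 2 ^ s)%:R by rewrite natrM natrX; ring.
  have -> : 2 * (c * n) = c * (2 * 3 ^ s)%:R by rewrite natrM /n; ring.
  by rewrite ler_pM2l// ler_nat; exact: nat_mul_exp2_le.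
have := le_trans H3 H2; rewrite ler_pM2r// ler_nat.
by [].
Qed.

End Main.

Unset Implicit Arguments.

Theorem theorem1p3 (R : realType) :
  (forall (E F : completeNormedModType R)
      (t2 : {bilinear c0 R -> c0 R -> E}) (t3 : {bilinear E -> c0 R -> F}),
    projective_tensor_product t2 -> projective_tensor_product t3 ->
    ~ isomorphic_to_subspace F E) /\
  (forall (E F : completeNormedModType R[i])
      (t2 : {bilinear c0 R[i] -> c0 R[i] -> E})
      (t3 : {bilinear E -> c0 R[i] -> F}),
    projective_tensor_product t2 -> projective_tensor_product t3 ->
    ~ isomorphic_to_subspace F E).
Proof.
split=> E F t2 t3 t2P t3P.
  exact: (triple_not_in_double (real_real_or_complex R) t2P t3P).
exact: (triple_not_in_double (complex_real_or_complex R) t2P t3P).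
Qed.
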